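(* Let $K$ and $L$ be Miljutin compacta of the same infinite weight $\kappa$. Suppose that each of $K$ and $L$ contains a closed copy of $2^\kappa$ (i.e. a closed subspace homeomorphic to the Cantor cube $2^\kappa=\{0,1\}^\kappa$). Then there is a positive isomorphism $T:C(K)\longrightarrow C(L)$ with regular inverse and such that \[ \|T\|_{\mathrm r}\cdot\|T^{-1}\|_{\mathrm r}\leq 9+6\sqrt3 . \]
   Context: Compact spaces are Hausdorff. All Banach lattices are real. $C(K)$ denotes the Banach lattice of real-valued continuous functions on the compact space $K$, with the supremum norm and pointwise order. An operator $S$ between Banach lattices is positive ($S\ge 0$) if $Sx\ge 0$ whenever $x\ge 0$. A positive isomorphism is a linear isomorphism (bounded linear bijection with bounded inverse) $T$ which is a positive operator; its inverse is not required to be positive. An operator $S$ is regular if it is the difference of two positive operators; its regular norm is $\|S\|_{\mathrm r}=\inf\{\|R\| : R\ge 0,\ -R\le S\le R\}$, where $A\le B$ for operators means $B-A\ge 0$. For a continuous surjection $\pi:K\to L$ between compact spaces, $\pi^*:C(L)\to C(K)$ is $\pi^*f=f\circ\pi$; a regular averaging operator for $\pi$ is a positive operator $A:C(K)\to C(L)$ with $A\pi^*=\mathrm{Id}_{C(L)}$. For an infinite cardinal $\kappa$, a compact space $K$ of weight $\kappa$ is a Miljutin compactum if there is a continuous surjection $\pi:2^\kappa\to K$ which admits a regular averaging operator. *)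

(* Defs.v *)
From HB Require Import structures.
From mathcomp Require Import all_boot all_order all_algebra.
From mathcomp Require Import all_classical all_reals all_analysis.

Set Implicit Arguments.
Unset Strict Implicit.
Unset Printing Implicit Defensive.

Import Order.TTheory GRing.Theory Num.Theory.
Import numFieldNormedType.Exports.

Local Open Scope classical_set_scope.
Local Open Scope card_scope.
Local Open Scope ring_scope.

HB.mixin Record isCompactHausdorff T of Topological T := {
  compactT : compact [set: T];
  hausdorffT : hausdorff_space T
}.

#[short(type="compactHausdorffType")]
HB.structure Definition CompactHausdorff :=
  {T of Topological T & isCompactHausdorff T}.

(* Cardinals are represented by types: [kappa] stands for the cardinality of
   [set: kappa]. *)
Definition cantor_cube (kappa : Type) : Type :=
  prod_topology (fun _ : kappa => bool).

Section cantor_cube.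
Variable kappa : Type.

HB.instance Definition _ := Topological.on (cantor_cube kappa).

Let cantor_cube_compact : compact [set: cantor_cube kappa].
Proof.
have := @tychonoff {classic kappa} (fun=> bool) (fun=> setT)
  (fun=> bool_compact).
by congr (compact _); apply/seteqP; split.
Qed.

Let cantor_cube_hausdorff : hausdorff_space (cantor_cube kappa).
Proof.
apply: (@hausdorff_product {classic kappa} (fun=> bool)) => _.
exact: discrete_hausdorff.
Qed.

HB.instance Definition _ := isCompactHausdorff.Build (cantor_cube kappa)
  cantor_cube_compact cantor_cube_hausdorff.

End cantor_cube.

(* The least cardinality of a base of [X] is that of [kappa]. *)
Definition has_weight (X : topologicalType) (kappa : Type) :=
  (exists2 B : set (set X), basis B & B #= [set: kappa]) /\
  (forall B : set (set X), basis B -> [set: kappa] #<= B).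

Definition homeomorphic (X Y : topologicalType) :=
  exists (f : X -> Y) (g : Y -> X),
    [/\ continuous f, continuous g, cancel f g & cancel g f].

Definition contains_closed_copy (X Y : topologicalType) :=
  exists2 F : set X, closed F & homeomorphic F Y.

Definition continuous_functions (R : realType) (K : compactHausdorffType) :
  Type := continuousType K R.

Notation "''C' [ R ] ( K )" := (continuous_functions R K)
  (at level 8, format "''C' [ R ] ( K )") : type_scope.

Section continuous_functions.
Variables (R : realType) (K : compactHausdorffType).
Implicit Types f g h : 'C[R](K).

HB.instance Definition _ := Choice.on 'C[R](K).

Definition cf_fun f : K -> R := (f : continuousType K R).
Coercion cf_fun : continuous_functions >-> Funclass.

Lemma cf_continuous f : continuous f.
Proof. exact: (@cts_fun _ _ (f : continuousType K R)). Qed.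

Lemma cf_ext f g : f =1 g -> f = g.
Proof. by move=> fg; exact/(@continuousEP _ _ f g). Qed.

Let add_cts f g : continuous (fun x => f x + g x).
Proof. by move=> x; apply: cvgD; exact: cf_continuous. Qed.

Let opp_cts f : continuous (fun x => - f x).
Proof. by move=> x; apply: cvgN; exact: cf_continuous. Qed.

Let zero_cts : continuous (fun _ : K => 0 : R).
Proof. by move=> x; exact: cvg_cst. Qed.

Let scale_cts (a : R) f : continuous (fun x => a * f x).
Proof. by move=> x; apply: cvgM; [exact: cvg_cst|exact: cf_continuous]. Qed.

Definition cf_add f g : 'C[R](K) :=
  (mkcts (@add_cts f g) : continuousType K R).
Definition cf_opp f : 'C[R](K) := (mkcts (@opp_cts f) : continuousType K R).
Definition cf_zero : 'C[R](K) := (mkcts zero_cts : continuousType K R).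
Definition cf_scale (a : R) f : 'C[R](K) :=
  (mkcts (@scale_cts a f) : continuousType K R).

Let cf_addA : associative cf_add.
Proof. by move=> f g h; apply: cf_ext => x; exact: addrA. Qed.
Let cf_addC : commutative cf_add.
Proof. by move=> f g; apply: cf_ext => x; exact: addrC. Qed.
Let cf_add0 : left_id cf_zero cf_add.
Proof. by move=> f; apply: cf_ext => x; exact: add0r. Qed.
Let cf_addN : left_inverse cf_zero cf_opp cf_add.
Proof. by move=> f; apply: cf_ext => x; exact: addNr. Qed.

HB.instance Definition _ := GRing.isZmodule.Build 'C[R](K)
  cf_addA cf_addC cf_add0 cf_addN.

Let cf_scaleA a b f : cf_scale a (cf_scale b f) = cf_scale (a * b) f.
Proof. by apply: cf_ext => x; exact: mulrA. Qed.
Let cf_scale1 : left_id 1 cf_scale.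
Proof. by move=> f; apply: cf_ext => x; exact: mul1r. Qed.
Let cf_scaleDr : right_distributive cf_scale +%R.
Proof. by move=> a f g; apply: cf_ext => x; exact: mulrDr. Qed.
Let cf_scaleDl f : {morph cf_scale^~ f : a b / a + b}.
Proof. by move=> a b; apply: cf_ext => x; exact: mulrDl. Qed.

HB.instance Definition _ := GRing.Zmodule_isLmodule.Build R 'C[R](K)
  cf_scaleA cf_scale1 cf_scaleDr cf_scaleDl.

Definition sup_norm f : R := sup (range (fun x => `|f x|)).

Lemma has_ubound_cf f : has_ubound (range (fun x => `|f x|)).
Proof.
have ctsn : continuous (fun x => `|f x|).
  by move=> x; apply: cvg_norm; exact: cf_continuous.
have : compact (range (fun x => `|f x|)).
  by apply: continuous_compact; [exact: continuous_subspaceT|exact: compactT].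
move=> /compact_bounded[M [_ Mb]]; exists (M + 1) => y fy.
by rewrite (le_trans (ler_norm y))// (Mb (M + 1))// ltrDl.
Qed.

Lemma ler_sup_norm f x : `|f x| <= sup_norm f.
Proof. by apply: ub_le_sup; [exact: has_ubound_cf|exists x]. Qed.

Lemma sup_norm_le f (M : R) : 0 <= M -> (forall x, `|f x| <= M) ->
  sup_norm f <= M.
Proof.
move=> M0 fM; have [e|/set0P ne] := eqVneq (range (fun x => `|f x|)) set0.
  by rewrite /sup_norm e sup0.
by apply: ge_sup => // _ [x _ <-].
Qed.

Lemma sup_norm_ge0 f : 0 <= sup_norm f.
Proof.
have [e|/set0P[_ [x _ _]]] := eqVneq (range (fun x => `|f x|)) set0.
  by rewrite /sup_norm e sup0.
exact: le_trans (ler_sup_norm f x).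
Qed.

Let sup_normD f g : sup_norm (f + g) <= sup_norm f + sup_norm g.
Proof.
apply: sup_norm_le => [|x]; first by rewrite addr_ge0// sup_norm_ge0.
by rewrite (le_trans (ler_normD _ _))// lerD// ler_sup_norm.
Qed.

Let sup_normZ (a : R) f : sup_norm (a *: f) = `|a| * sup_norm f.
Proof.
apply/eqP; rewrite eq_le; apply/andP; split.
  apply: sup_norm_le => [|x]; first by rewrite mulr_ge0// sup_norm_ge0.
  by rewrite normrM ler_wpM2l// ler_sup_norm.
have [->|a0] := eqVneq a 0; first by rewrite normr0 mul0r sup_norm_ge0.
rewrite -ler_pdivlMl ?normr_gt0//; apply: sup_norm_le => [|x].
  by rewrite mulr_ge0 ?invr_ge0// sup_norm_ge0.
by rewrite ler_pdivlMl ?normr_gt0// -normrM (ler_sup_norm (a *: f)).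
Qed.

Let sup_norm_eq0 f : sup_norm f = 0 -> f = 0.
Proof.
move=> f0; apply: cf_ext => x; apply/eqP.
by rewrite -normr_le0 -f0 ler_sup_norm.
Qed.

HB.instance Definition _ := Lmodule_isNormed.Build R 'C[R](K)
  sup_normD sup_normZ sup_norm_eq0.

Definition cf_le f g : bool := `[< forall x, f x <= g x >].

Let cf_le_refl : reflexive cf_le.
Proof. by move=> f; apply/asboolP. Qed.
Let cf_le_anti : antisymmetric cf_le.
Proof.
move=> f g /andP[/asboolP fg /asboolP gf]; apply: cf_ext => x.
by apply/eqP; rewrite eq_le fg gf.
Qed.
Let cf_le_trans : transitive cf_le.
Proof.
move=> g f h /asboolP fg /asboolP gh; apply/asboolP => x.
exact: le_trans (fg x) (gh x).
Qed.

HB.instance Definition _ := Order.Le_isPOrder.Build ring_display 'C[R](K)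
  cf_le_refl cf_le_anti cf_le_trans.

Lemma cf_leP f g : reflect (forall x, f x <= g x) (f <= g).
Proof. exact: asboolP. Qed.

End continuous_functions.

Section operators.
Variables (R : realType) (K L : compactHausdorffType).
Implicit Types S T Q : {linear 'C[R](K) -> 'C[R](L)}.

Definition bounded_operator S :=
  exists M : R, forall f, `|S f| <= M * `|f|.

Definition operator_norm S : R := sup [set `|S f| | f in [set f | `|f| <= 1]].

Definition positive_operator S :=
  bounded_operator S /\ forall f, 0 <= f -> 0 <= S f.

Definition operator_le S T := positive_operator (T \- S).

Definition regular_operator S :=
  exists A B : {linear 'C[R](K) -> 'C[R](L)},
    [/\ positive_operator A, positive_operator B & S =1 A \- B].

(* As [inf set0 = 0], this is meaningful for regular [S] only. *)
Definition regular_norm S : R :=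
  inf [set operator_norm Q | Q in
    [set Q | [/\ positive_operator Q, operator_le (\- Q) S & operator_le S Q]]].

End operators.

(* The inverse of a linear bijection being linear, it is given as a linear map
   [T']. Only [T] is required to be positive. *)
Definition positive_isomorphism (R : realType) (K L : compactHausdorffType)
    (T : {linear 'C[R](K) -> 'C[R](L)}) (T' : {linear 'C[R](L) -> 'C[R](K)}) :=
  [/\ positive_operator T, bounded_operator T', cancel T T' & cancel T' T].

Definition pullback (R : realType) (K L : compactHausdorffType)
  (p : continuousType K L) (f : 'C[R](L)) : 'C[R](K) :=
  (((f : continuousType L R) \o p : K -> R) : continuousType K R).

Definition regular_averaging_operator (R : realType)
    (K L : compactHausdorffType) (p : continuousType K L)
    (A : {linear 'C[R](K) -> 'C[R](L)}) :=
  positive_operator A /\ cancel (pullback p) A.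

Definition Miljutin_compactum (R : realType) (kappa : Type)
    (K : compactHausdorffType) :=
  has_weight K kappa /\
  exists p : continuousType (cantor_cube kappa) K,
    range p = [set: K] /\
    exists A : {linear 'C[R](cantor_cube kappa) -> 'C[R](K)},
      regular_averaging_operator p A.

(* Main.v *)
Require Import Defs.
From HB Require Import structures.
From mathcomp Require Import all_boot all_order all_algebra.
From mathcomp Require Import all_classical all_reals all_analysis.
From mathcomp Require Import ring lra.

(* Write X = C(K), Y = C(L), D = C(2^kappa), and let c(X) be the space of
   convergent sequences in X. As K is an averaging image of 2^kappa, X is
   positively complemented in D, and so is c(X). As L contains a copy of
   2^kappa, so is D in Y: the map from the preimage of the copy in 2^kappa to
   the copy extends to 2^kappa, and averaging turns the extension into an
   extension operator. Hence Y contains a positively complemented copy of c(X), and X one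
   of c(Y).

   Pelczynski's decomposition then removes the first term y_1 of the copy of
   c(Y) in X by a left shift, and inserts what remains of x in front of the
   copy of c(X) in y_1 by a right shift. The isomorphism obtained so is not
   positive, since the shifts have to fix a complement; the remedy is to perturb
   it. With ga the first term of the c(Y)-part, U' the left shift of this part
   (and 0 on a complement), i and V the insertion as a first term and the right
   shift of the c(X)-part of Y,
     T x = g ga(x) + i (a x + b U' x) + V ga(x)
   is positive. It is invertible when g < 1 and a < b, by Neumann series in g U
   and in (a/b) V', for the left shift U of Y and the right shift V' of X; the
   bound on the product of the norms is least for g = 2 - sqrt 3 and
   b = 1/sqrt 3 = 1 - a. *)

Set Implicit Arguments.
Unset Strict Implicit.
Unset Printing Implicit Defensive.

Import Order.TTheory GRing.Theory Num.Theory.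
Import numFieldNormedType.Exports.

Local Open Scope classical_set_scope.
Local Open Scope ring_scope.

Notation "f \at x" := (cf_fun f x) (at level 11, x at level 9).

Arguments cf_fun : simpl never.

(** * Evaluation in C(K) and uniform limits *)

Section evaluation.
Variables (R : realType) (K : compactHausdorffType).
Implicit Types f g : 'C[R](K).

Lemma cf_addE f g x : (f + g) \at x = f x + g x. Proof. by []. Qed.
Lemma cf_oppE f x : (- f) \at x = - f x. Proof. by []. Qed.
Lemma cf_scaleE (a : R) f x : (a *: f) \at x = a * f x. Proof. by []. Qed.
Lemma cf_zeroE x : (0 : 'C[R](K)) \at x = 0. Proof. by []. Qed.

Definition cf_make (f : K -> R) (cf : continuous f) : 'C[R](K) :=
  (mkcts cf : continuousType K R).

Lemma cf_makeE f (cf : continuous f) x : cf_make cf \at x = f x.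
Proof. by []. Qed.

Definition cf_cst (c : R) : 'C[R](K) := cf_make (fun x => cvg_cst c).

Lemma cf_cstE c x : cf_cst c \at x = c. Proof. by []. Qed.

Lemma cf_cst_scale (c : R) : cf_cst c = c *: cf_cst 1.
Proof. apply: cf_ext => x. by rewrite cf_scaleE !cf_cstE mulr1. Qed.

Lemma cf_norm_ge f x : `|f x| <= `|f|. Proof. exact: ler_sup_norm. Qed.

End evaluation.
Arguments cf_cst {R K}.
Definition cfE := (cf_addE, cf_oppE, cf_scaleE, cf_zeroE, cf_cstE, cf_makeE).

(** Pointwise, [u n - c * r ^+ n] increases and [u n + c * r ^+ n] decreases, so the supremum of the
    former lies between them for every n. The convergence is thus uniform and the limit
    continuous. *)
Lemma geometric_cauchy_limit (R : realType) (K : compactHausdorffType)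
    (u : nat -> 'C[R](K)) (c r : R) : 0 <= r < 1 -> 0 <= c ->
  (forall n x, `|u n.+1 \at x - u n \at x| <= c * (1 - r) * r ^+ n) ->
  exists h : 'C[R](K), forall n x, `|h x - u n \at x| <= c * r ^+ n.
Proof.
move=> /andP[r0 r1] c0 uc.
have rn0 n : 0 <= r ^+ n by exact: exprn_ge0.
pose w x n := u n \at x - c * r ^+ n.
pose W x n := u n \at x + c * r ^+ n.
have w1 x n : w x n <= w x n.+1.
  rewrite /w exprS; have := uc n x; rewrite ler_norml => /andP[+ _]; nra.
have W1 x n : W x n.+1 <= W x n.
  rewrite /W exprS; have := uc n x; rewrite ler_norml => /andP[_ +]; nra.
have wW x m n : w x m <= W x n.
  have wh : {homo w x : m n / (m <= n)%N >-> m <= n}.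
    by apply: homo_leq => [|? ? ?|]; [exact: lexx|exact: le_trans|exact: w1].
  have Wh : {homo W x : m n / (m <= n)%N >-> n <= m}.
    apply: homo_leq => [?|y ? ? xy yz|]; [exact: lexx| |exact: W1].
    exact: le_trans yz xy.
  apply: le_trans (wh _ _ (leq_maxl m n)) (le_trans _ (Wh _ _ (leq_maxr m n))).
  rewrite /w /W; have := mulr_ge0 c0 (rn0 (maxn m n)); lra.
pose h x := sup (range (w x)).
have hu n x : `|h x - u n \at x| <= c * r ^+ n.
  have wh : w x n <= h x.
    apply: ub_le_sup; last by exists n.
    by exists (W x 0%N) => _ [m _ <-].
  have hW : h x <= W x n.
    by apply: ge_sup => [|_ [m _ <-]//]; exists (w x 0%N); exists 0%N.
  by rewrite ler_norml; move: wh hW; rewrite /w /W => *; apply/andP; split; lra.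
have hc : continuous h.
  move=> x; apply/cvgrPdist_lt => e e0.
  have [n ne] : exists n, c * r ^+ n < e / 3.
    have /cvgrPdist_lt/(_ (e / 3)) : geometric c r @ \oo --> 0.
      by apply: cvg_geometric; rewrite ger0_norm.
    rewrite divr_gt0// => /(_ erefl)[n _ /(_ n (leqnn n))/=].
    by rewrite sub0r normrN ger0_norm ?mulr_ge0//; exists n.
  have /cvgrPdist_lt/(_ (e / 3)) := @cf_continuous _ _ (u n) x.
  rewrite divr_gt0// => /(_ erefl); apply: filterS => y uxy.
  have := hu n x; have := hu n y; move: uxy ne.
  rewrite !ler_norml !ltr_norml => /andP[? ?] ? /andP[? ?] /andP[? ?].
  apply/andP; split; lra.
by exists (cf_make hc).
Qed.

(** * Positive operators and domination *)

Section domination.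
Variables (R : realType).

Definition nonneg_map (K L : compactHausdorffType) (S : 'C[R](K) -> 'C[R](L)) :=
  forall f : 'C[R](K), (forall x, 0 <= f x) -> forall y, 0 <= S f \at y.

(** For linear maps this amounts to -Q <= S <= Q. Testing on pairs [|f| <= g] makes it stable under
    composition without using lattice operations on functions. *)
Definition dominated (K L : compactHausdorffType)
    (S Q : 'C[R](K) -> 'C[R](L)) :=
  forall f g : 'C[R](K), (forall x, `|f x| <= g x) ->
  forall y, `|S f \at y| <= Q g \at y.

Section linear.
Variables (K L : compactHausdorffType) (S : {linear 'C[R](K) -> 'C[R](L)}).
Hypothesis S0 : nonneg_map S.

Lemma nonneg_map_le (f g : 'C[R](K)) :
  (forall x, f x <= g x) -> forall y, S f \at y <= S g \at y.
Proof.
move=> fg y; rewrite -subr_ge0.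
have := @S0 (g - f) _ y; rewrite linearB; apply => x.
by rewrite !cfE subr_ge0.
Qed.

Lemma nonneg_map_dominated : dominated S S.
Proof.
move=> f g fg y; rewrite ler_norml; apply/andP; split.
  have := @nonneg_map_le (- g) f _ y; rewrite linearN; apply => x.
  by have := fg x; rewrite ler_norml => /andP[].
by apply: nonneg_map_le => x; have := fg x; rewrite ler_norml => /andP[].
Qed.

Lemma nonneg_map_le_cst (M c : R) :
  0 <= c -> (forall y, S (cf_cst 1) \at y <= M) ->
  forall f : 'C[R](K), (forall x, f x <= c) -> forall y, S f \at y <= M * c.
Proof.
move=> c0 SM f fc y; have := @nonneg_map_le f (cf_cst c) fc y.
move=> /le_trans; apply; rewrite cf_cst_scale linearZ cfE mulrC.
by rewrite ler_wpM2r.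
Qed.

End linear.

Lemma dominated_sup_norm (K L : compactHausdorffType)
    (S : 'C[R](K) -> 'C[R](L)) (Q : {linear 'C[R](K) -> 'C[R](L)}) (M : R) :
  dominated S Q -> (forall y, Q (cf_cst 1) \at y <= M) -> 0 <= M ->
  forall f, `|S f| <= M * `|f|.
Proof.
move=> SQ QM M0 f; apply: sup_norm_le => [|y]; first by rewrite mulr_ge0.
have f1 x : `|f x| <= (`|f| *: cf_cst 1) \at x.
  by rewrite !cfE mulr1 cf_norm_ge.
apply: le_trans (SQ _ _ f1 y) _.
by rewrite linearZ !cfE mulrC ler_wpM2r.
Qed.

End domination.

(** * Resolvents of positive contractions *)

Section neumann.
Variables (R : realType) (K : compactHausdorffType).
Variable S : {linear 'C[R](K) -> 'C[R](K)}.
Hypotheses (S0 : nonneg_map S) (S1 : forall x, S (cf_cst 1) \at x <= 1).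

(** A comparison principle: k is a supersolution of the majorant equation. If |h| <= k + M m^n, then
    the equation for h and S 1 <= 1 improve the error to M m^(n+1). It gives uniqueness with k = 0,
    norm bounds with k constant, and domination of one resolvent by another. *)
Lemma resolvent_dominated (l m : R) (f g h k : 'C[R](K)) :
  `|l| <= m -> m < 1 -> (forall x, `|f x| <= g x) ->
  h = f + l *: S h -> (forall x, g x + m * S k \at x <= k x) ->
  forall x, `|h x| <= k x.
Proof.
move=> lm m1 fg hE kE.
have m0 : 0 <= m by exact: le_trans lm.
pose M : R := `|h| + `|k|.
have M0 : 0 <= M by rewrite addr_ge0.
have H n x : `|h x| <= k x + M * m ^+ n.
  elim: n x => [|n IH] x.
    rewrite expr0 mulr1 /M; have := cf_norm_ge h x; have := cf_norm_ge k x.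
    by rewrite [`|k \at x| <= _]ler_norml => /andP[? _] ?; lra.
  have Sh : `|S h \at x| <= S k \at x + M * m ^+ n.
    have hk y : `|h y| <= (k + (M * m ^+ n) *: cf_cst 1) \at y.
      by rewrite !cfE mulr1.
    apply: le_trans (nonneg_map_dominated S0 hk x) _.
    rewrite linearD linearZ !cfE.
    by rewrite lerD2l ler_piMr// mulr_ge0// exprn_ge0.
  rewrite hE !cfE (le_trans (ler_normD _ _))// normrM.
  have lS : `|l| * `|S h \at x| <= m * (S k \at x + M * m ^+ n) by exact: ler_pM.
  by have := fg x; have := kE x; rewrite exprS; lra.
move=> x; apply/ler_addgt0Pl => e e0.
have /cvgrPdist_lt/(_ e e0) : geometric M m @ \oo --> 0.
  by apply: cvg_geometric; rewrite ger0_norm.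
case=> n _ /(_ n (leqnn n))/=; rewrite sub0r normrN => /ltW ne.
by have := H n x; rewrite ler_norml in ne; case/andP: ne => _ ?; lra.
Qed.

Lemma resolvent_unique (l : R) (f h h' : 'C[R](K)) : `|l| < 1 ->
  h = f + l *: S h -> h' = f + l *: S h' -> h = h'.
Proof.
move=> l1 hE h'E; apply/eqP; rewrite -subr_eq0; apply/eqP/cf_ext => x.
apply/eqP; rewrite -normr_le0.
apply: (@resolvent_dominated l `|l| 0 0 (h - h') 0) => //.
- by move=> y; rewrite normr0.
- by rewrite {1}hE {1}h'E linearB scalerBr add0r opprD addrACA subrr add0r.
- by move=> y; rewrite linear0 !cfE mulr0 addr0.
Qed.

(** The solution is the limit of the iteration h -> f + l S h, which contracts by |l|; linearity of
    the solution map comes from uniqueness. *)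
Lemma resolvent_exists (l : R) : `|l| < 1 ->
  exists N : {linear 'C[R](K) -> 'C[R](K)}, forall f, N f = f + l *: S (N f).
Proof.
move=> l1.
have Snorm (f : 'C[R](K)) (c : R) :
    (forall x, `|f x| <= c) -> forall x, `|S f \at x| <= c.
  move=> fc x; have c0 : 0 <= c by exact: le_trans (fc x).
  apply: le_trans (nonneg_map_dominated S0 (g := cf_cst c) fc x) _.
  rewrite -[leRHS]mul1r.
  by apply: nonneg_map_le_cst => // y; rewrite cfE.
have ex f : exists h, h = f + l *: S h.
  pose u n := iter n (fun h => f + l *: S h) f.
  have uS n : u n.+1 = f + l *: S (u n) by [].
  pose c : R := `|u 1%N - u 0%N| / (1 - `|l|).
  have l1' : 0 < 1 - `|l| by rewrite subr_gt0.
  have c0 : 0 <= c by rewrite divr_ge0// ltW.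
  have uc n x : `|u n.+1 \at x - u n \at x| <= c * (1 - `|l|) * `|l| ^+ n.
    rewrite divfK ?gt_eqF//.
    elim: n x => [|n IH] x.
      by rewrite expr0 mulr1 (ler_sup_norm (u 1%N - u 0%N)).
    rewrite (uS n.+1) [u n.+1 in X in _ - X]uS.
    have -> : (f + l *: S (u n.+1)) \at x - (f + l *: S (u n)) \at x =
              l * S (u n.+1 - u n) \at x by rewrite linearB !cfE; ring.
    rewrite normrM exprS mulrCA ler_wpM2l//; apply: Snorm => y.
    exact: IH.
  have l01 : 0 <= `|l| < 1 by rewrite normr_ge0.
  have [h hu] := geometric_cauchy_limit l01 c0 uc.
  exists h; apply/eqP; rewrite -subr_eq0; apply/eqP/cf_ext => x.
  apply/eqP; rewrite -normr_le0; apply/ler_addgt0Pl => e e0; rewrite addr0.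
  (* The defect of h in the equation is at most 2 c |l|^n: one c |l|^n for replacing h by [u n.+1],
     one for replacing [S h] by [S (u n)]. *)
  have /cvgrPdist_lt/(_ e e0) : geometric (c + c) `|l| @ \oo --> 0.
    by apply: cvg_geometric; rewrite normr_id.
  case=> n _ /(_ n (leqnn n))/=; rewrite sub0r normrN => /ltW.
  rewrite ler_norml => /andP[_ +]; apply: le_trans.
  have -> : (h - (f + l *: S h)) \at x =
            (h x - u n.+1 \at x) + l * S (u n - h) \at x.
    by rewrite uS linearB !cfE; ring.
  rewrite (le_trans (ler_normD _ _))// mulrDl lerD//.
    apply: le_trans (hu _ _) _; rewrite exprS ler_wpM2l// ler_piMl ?exprn_ge0//.
    exact: ltW.
  rewrite normrM; apply: le_trans (_ : 1 * (c * `|l| ^+ n) <= _).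
    2: by rewrite mul1r.
  apply: ler_pM => //; first exact: ltW.
  by apply: Snorm => y; rewrite !cfE -opprB normrN.
pose N f := projT1 (cid (ex f)).
have NE f : N f = f + l *: S (N f) by exact: projT2 (cid (ex f)).
have Nl : linear N.
  move=> a f g; apply: (resolvent_unique l1 (NE _)).
  by rewrite {1}(NE f) {1}(NE g) linearP !scalerDr !scalerA (mulrC a) addrACA.
pose N' : {linear 'C[R](K) -> 'C[R](K)} :=
  HB.pack N (GRing.isLinear.Build R _ _ _ N Nl).
by exists N'.
Qed.

End neumann.

(* The convergent sequences in [C(K)], as a complemented subspace of [C(L)]:
   [sh_proj] is the projection onto it, [sh_left] and [sh_right] are the left
   shift and the right shift (inserting [0]), both precomposed with the
   projection; [sh_in] and [sh_out] are the inclusion and the evaluation of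
   the first term. *)
Record shift_system (R : realType) (K L : compactHausdorffType) := ShiftSystem {
  sh_proj : {linear 'C[R](L) -> 'C[R](L)};
  sh_left : {linear 'C[R](L) -> 'C[R](L)};
  sh_right : {linear 'C[R](L) -> 'C[R](L)};
  sh_in : {linear 'C[R](K) -> 'C[R](L)};
  sh_out : {linear 'C[R](L) -> 'C[R](K)};
  sh_proj_ge0 : nonneg_map sh_proj;
  sh_left_ge0 : nonneg_map sh_left;
  sh_right_ge0 : nonneg_map sh_right;
  sh_in_ge0 : nonneg_map sh_in;
  sh_out_ge0 : nonneg_map sh_out;
  sh_proj_le1 : forall y, sh_proj (cf_cst 1) \at y <= 1;
  sh_left_le1 : forall y, sh_left (cf_cst 1) \at y <= 1;
  sh_out_le1 : forall x, sh_out (cf_cst 1) \at x <= 1;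
  sh_in_right_le1 : forall y,
    sh_in (cf_cst 1) \at y + sh_right (cf_cst 1) \at y <= 1;
  sh_projK : forall f, sh_proj (sh_proj f) = sh_proj f;
  sh_left_proj : forall f, sh_left (sh_proj f) = sh_left f;
  sh_proj_left : forall f, sh_proj (sh_left f) = sh_left f;
  sh_right_proj : forall f, sh_right (sh_proj f) = sh_right f;
  sh_proj_right : forall f, sh_proj (sh_right f) = sh_right f;
  sh_proj_in : forall f, sh_proj (sh_in f) = sh_in f;
  sh_out_proj : forall f, sh_out (sh_proj f) = sh_out f;
  sh_left_right : forall f, sh_left (sh_right f) = sh_proj f;
  sh_left_in : forall f, sh_left (sh_in f) = 0;
  sh_out_in : forall f, sh_out (sh_in f) = f;
  sh_out_right : forall f, sh_out (sh_right f) = 0;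
  sh_split : forall f, sh_in (sh_out f) + sh_right (sh_left f) = sh_proj f
}.

Lemma sh_right_le1 (R : realType) (K L : compactHausdorffType)
  (s : shift_system R K L) y : sh_right s (cf_cst 1) \at y <= 1.
Proof.
have := sh_in_right_le1 s y; apply: le_trans; rewrite lerDr.
by apply: sh_in_ge0 => x; rewrite cfE.
Qed.

(** * The isomorphism built from two shift systems *)

Section shift_isomorphism.
Variables (R : realType) (K L : compactHausdorffType).
Variables (s : shift_system R K L) (t : shift_system R L K).
Variables (g a b C : R).
Hypotheses (g0 : 0 < g) (g1 : g < 1) (a0 : 0 < a) (ab : a < b).
Hypothesis ab1 : a + b = 1.
Hypothesis gC : 2 / g + (1 - g)^-1 <= C.
Hypothesis abC : (1 - g)^-1 <= (b - a) * C.

Local Notation X := 'C[R](K).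
Local Notation Y := 'C[R](L).

Let b0 : 0 < b. Proof. exact: lt_trans ab. Qed.

Let mixed : {linear X -> X} := (a \*: idfun) \+ (b \*: sh_left t).

Definition shift_iso : {linear X -> Y} :=
  (g \*: sh_out t) \+ (sh_in s \o mixed) \+ (sh_right s \o sh_out t).

Lemma shift_isoE x : shift_iso x =
  g *: sh_out t x + sh_in s (a *: x + b *: sh_left t x) +
  sh_right s (sh_out t x).
Proof. by []. Qed.

(** With U the left shift of [s] and V' the right shift of [t], [NU] and [NV] stand for (1 + g U)^-1
    and (1 + (a/b) V')^-1, which enter the inverse; [NU'] and [NV'], of opposite sign, majorize
    them. *)
Variables (NU NU' : {linear Y -> Y}) (NV NV' : {linear X -> X}).
Hypothesis NUE : forall y, NU y = y + (- g) *: sh_left s (NU y).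
Hypothesis NU'E : forall y, NU' y = y + g *: sh_left s (NU' y).
Hypothesis NVE : forall x, NV x = x + (- (a / b)) *: sh_right t (NV x).
Hypothesis NV'E : forall x, NV' x = x + (a / b) *: sh_right t (NV' x).

(* The inverse is obtained for [e = -1], a majorant of it for [e = 1]. *)
Section inverse_formula.
Variables (e : R) (N : {linear Y -> Y}) (N' : {linear X -> X}).

(** Let P, P' be the projections of [s], [t], and U' the left shift of [t]. For e = -1 and y = T x,
    with v = [sh_out t x], the formulas [inv_proj], [inv_out], [inv_mixed], [inv_seq] recover P v,
    v, z = a x + b U' x and P' x in turn. As P' U' = U', z - P' z = a (x - P' x), which yields the
    rest of x. *)
Definition inv_proj : {linear Y -> Y} := N \o sh_left s.
Definition inv_out : {linear Y -> Y} :=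
  (g^-1 \*: (idfun \+ (e \*: sh_proj s))) \+ inv_proj.
Definition inv_mixed : {linear Y -> X} :=
  sh_out s \+ ((e * g) \*: (sh_out s \o inv_proj)).
Definition inv_seq : {linear Y -> X} :=
  N' \o ((sh_in t \o inv_out) \+ (b^-1 \*: (sh_right t \o inv_mixed))).
Definition inv_formula : {linear Y -> X} :=
  (a^-1 \*: (inv_mixed \+ (e \*: (sh_proj t \o inv_mixed)))) \+ inv_seq.

Lemma inv_formulaE y : inv_formula y =
  a^-1 *: (inv_mixed y + e *: sh_proj t (inv_mixed y)) + inv_seq y.
Proof. by []. Qed.

End inverse_formula.

Definition shift_inv := inv_formula (- 1) NU NV.
Definition shift_inv_majorant := inv_formula 1 NU' NV'.

Let g_lt1 : `|- g| < 1. Proof. by rewrite normrN gtr0_norm. Qed.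
Let ab_lt1 : `|- (a / b)| < 1.
Proof. by rewrite normrN gtr0_norm ?divr_gt0// ltr_pdivrMr// mul1r. Qed.

Lemma shift_isoK : cancel shift_iso shift_inv.
Proof.
move=> x; have [v vE] : exists v, v = sh_out t x by eexists.
have [z zE] : exists z, z = a *: x + b *: sh_left t x by eexists.
have [y yE] : exists y, y = shift_iso x by eexists.
rewrite -{1}yE; rewrite shift_isoE -zE -vE in yE.
(* U kills the inserted first term and undoes the right shift, so U y = g U v + P v; hence P v
   solves p = U y - g U p. *)
have h1 : inv_proj NU y = sh_proj s v.
  apply: (resolvent_unique (@sh_left_ge0 _ _ _ s) (@sh_left_le1 _ _ _ s)
    g_lt1 (NUE _)).
  rewrite yE !linearD linearZ sh_left_in sh_left_right sh_left_proj.
  by apply: cf_ext => k; rewrite !cfE; ring.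
(* The last two summands of y lie in the range of P, so y - P y = g (v - P v). *)
have h2 : inv_out (- 1) NU y = v.
  have -> : inv_out (- 1) NU y =
    g^-1 *: (y + (- 1) *: sh_proj s y) + inv_proj NU y by [].
  have -> : sh_proj s y = g *: sh_proj s v + sh_in s z + sh_right s v.
    by rewrite yE !linearD linearZ sh_proj_in sh_proj_right.
  rewrite h1 yE.
  by apply: cf_ext => k; rewrite !cfE; field; rewrite gt_eqF.
have h3 : inv_mixed (- 1) NU y = z.
  have -> : inv_mixed (- 1) NU y =
    sh_out s y + (- 1 * g) *: sh_out s (inv_proj NU y) by [].
  have -> : sh_out s y = g *: sh_out s v + z.
    by rewrite yE !linearD linearZ sh_out_in sh_out_right addr0.
  rewrite h1 sh_out_proj.
  by apply: cf_ext => k; rewrite !cfE; ring.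
(* By [sh_split], P' x is the insertion of v plus V' U' x, and b U' x = z - a x. So P' x solves the
   equation of [NV]. *)
have h4 : inv_seq (- 1) NU NV y = sh_proj t x.
  have -> : inv_seq (- 1) NU NV y = NV (sh_in t v + b^-1 *: sh_right t z).
    by rewrite -h2 -h3.
  apply: (resolvent_unique (@sh_right_ge0 _ _ _ t) _ ab_lt1 (NVE _)).
    by move=> k; apply: sh_right_le1.
  have -> : sh_right t z = a *: sh_right t x + b *: sh_right t (sh_left t x).
    by rewrite zE linearD !linearZ.
  rewrite sh_right_proj -(sh_split t x) vE.
  by apply: cf_ext => k; rewrite !cfE; field; rewrite gt_eqF.
have zP : sh_proj t z = a *: sh_proj t x + b *: sh_left t x.
  by rewrite zE linearD !linearZ sh_proj_left.
rewrite /shift_inv inv_formulaE h3 h4 zP zE.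
by apply: cf_ext => k; rewrite !cfE; field; rewrite gt_eqF.
Qed.

(** The pieces p, v, z, q computed from y are shown to be those of x = [shift_inv y]: [sh_out t x] =
    v and a x + b U' x = z. Substituting them into T x gives back y. *)
Lemma shift_invK : cancel shift_inv shift_iso.
Proof.
move=> y; have [p pE] : exists p, p = inv_proj NU y by eexists.
have [v vE] : exists v, v = inv_out (- 1) NU y by eexists.
have [z zE] : exists z, z = inv_mixed (- 1) NU y by eexists.
have [q qE] : exists q, q = inv_seq (- 1) NU NV y by eexists.
have [x xE] : exists x, x = shift_inv y by eexists.
rewrite -{1}xE; rewrite /shift_inv inv_formulaE -zE -qE in xE.
have {}qE : q = sh_in t v + b^-1 *: sh_right t z + (- (a / b)) *: sh_right t q.
  by rewrite qE vE zE; exact: NVE.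
have {}zE : z = sh_out s y + (- 1 * g) *: sh_out s p by rewrite zE pE.
have {}vE : v = g^-1 *: (y + (- 1) *: sh_proj s y) + p by rewrite vE pE.
have {}pE : p = sh_left s y + (- g) *: sh_left s p by rewrite pE; exact: NUE.
have Pp : sh_proj s p = p by rewrite pE linearD linearZ !sh_proj_left.
have Pq : sh_proj t q = q.
  by rewrite qE !linearD !linearZ sh_proj_in !sh_proj_right.
have Pv : sh_proj s v = p.
  rewrite vE linearD linearZ Pp linearD linearZ sh_projK.
  by apply: cf_ext => k; rewrite !cfE; ring.
have out_q : sh_out t q = v.
  rewrite qE !linearD !linearZ sh_out_in !sh_out_right.
  by apply: cf_ext => k; rewrite !cfE; ring.
have out_x : sh_out t x = v.
  rewrite xE linearD linearZ linearD linearZ sh_out_proj out_q.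
  by apply: cf_ext => k; rewrite !cfE; ring.
have left_q : sh_left t q = b^-1 *: sh_proj t z + (- (a / b)) *: q.
  rewrite {1}qE !linearD !linearZ sh_left_in !sh_left_right Pq.
  by apply: cf_ext => k; rewrite !cfE; ring.
have left_x : sh_left t x = sh_left t q.
  rewrite xE linearD linearZ linearD linearZ sh_left_proj.
  by apply: cf_ext => k; rewrite !cfE; ring.
have mixed_x : a *: x + b *: sh_left t x = z.
  rewrite left_x left_q xE.
  by apply: cf_ext => k; rewrite !cfE; field; rewrite !gt_eqF.
have right_v : sh_right s v =
    sh_right s (sh_left s y) + (- g) *: sh_right s (sh_left s p).
  by rewrite -(sh_right_proj s v) Pv {1}pE linearD linearZ.
have in_z : sh_in s z =
    sh_in s (sh_out s y) + (- 1 * g) *: sh_in s (sh_out s p).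
  by rewrite zE linearD linearZ.
rewrite shift_isoE out_x mixed_x right_v in_z; apply: cf_ext => k.
(* Here g v = y - P y + g p. The remaining terms reassemble to P y - g p by the splittings of y and
   of p = P p. *)
have := congr1 (fun f : Y => f k) (sh_split s y).
have := congr1 (fun f : Y => f k) (sh_split s p).
rewrite vE Pp !cfE => sp sy; have : g * g^-1 = 1 by rewrite divff ?gt_eqF.
move: sp sy; set u := g^-1; move=> sp sy gu.
by rewrite mulrDr mulrA gu; nra.
Qed.

(** The majorant arises by making every sign positive. The pieces are compared one after the other,
    the two resolvents by [resolvent_dominated]. *)
Lemma shift_inv_dominated : dominated shift_inv shift_inv_majorant.
Proof.
move=> f h fh.
have dom K1 K2 (S : {linear 'C[R](K1) -> 'C[R](K2)}) :=
  @nonneg_map_dominated R _ _ S.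
have ginv0 : 0 <= g^-1 by rewrite invr_ge0 ltW.
have binv0 : 0 <= b^-1 by rewrite invr_ge0 ltW.
have ainv0 : 0 <= a^-1 by rewrite invr_ge0 ltW.
have pD k : `|inv_proj NU f \at k| <= inv_proj NU' h \at k.
  apply: (resolvent_dominated (@sh_left_ge0 _ _ _ s) (@sh_left_le1 _ _ _ s)
    (l := - g) (m := g) (f := sh_left s f) (g := sh_left s h)) => //.
  - by rewrite normrN gtr0_norm.
  - by apply: dom => //; exact: sh_left_ge0.
  - exact: NUE.
  - by move=> x; rewrite [leRHS](congr1 (fun f : Y => f x) (NU'E _)) !cfE.
have vD k : `|inv_out (- 1) NU f \at k| <= inv_out 1 NU' h \at k.
  rewrite !cfE (le_trans (ler_normD _ _))// lerD ?pD//.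
  rewrite normrM ger0_norm// ler_wpM2l//.
  rewrite (le_trans (ler_normD _ _))// lerD// mulN1r normrN mul1r.
  by apply: dom => //; exact: sh_proj_ge0.
have zD k : `|inv_mixed (- 1) NU f \at k| <= inv_mixed 1 NU' h \at k.
  rewrite !cfE (le_trans (ler_normD _ _))// lerD//.
    by apply: dom => //; exact: sh_out_ge0.
  rewrite mulN1r mul1r normrM normrN (gtr0_norm g0) (ler_wpM2l (ltW g0))//.
  exact: (dom _ _ _ (@sh_out_ge0 _ _ _ s) _ _ pD).
have qD k : `|inv_seq (- 1) NU NV f \at k| <= inv_seq 1 NU' NV' h \at k.
  apply: (resolvent_dominated (@sh_right_ge0 _ _ _ t) (@sh_right_le1 _ _ _ t)
    (l := - (a / b)) (m := a / b) (f := sh_in t (inv_out (- 1) NU f) +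
       b^-1 *: sh_right t (inv_mixed (- 1) NU f))
    (g := sh_in t (inv_out 1 NU' h) +
       b^-1 *: sh_right t (inv_mixed 1 NU' h))) => //.
  - by rewrite normrN gtr0_norm// divr_gt0.
  - by rewrite ltr_pdivrMr// mul1r.
  - move=> x; rewrite !cfE (le_trans (ler_normD _ _))// lerD//.
      exact: (dom _ _ _ (@sh_in_ge0 _ _ _ t) _ _ vD).
    rewrite normrM ger0_norm// ler_wpM2l//.
    exact: (dom _ _ _ (@sh_right_ge0 _ _ _ t) _ _ zD).
  - exact: NVE.
  - by move=> x; rewrite [leRHS](congr1 (fun f : X => f x) (NV'E _)) !cfE.
move=> k; rewrite /shift_inv /shift_inv_majorant !inv_formulaE.
have PD := dom _ _ _ (@sh_proj_ge0 _ _ _ t) _ _ zD k.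
move: (inv_mixed (- 1) NU f) (inv_mixed 1 NU' h) (inv_seq (- 1) NU NV f)
  (inv_seq 1 NU' NV' h) (zD k) (qD k) PD => z z' q q' zk qk Pk.
rewrite !cfE (le_trans (ler_normD _ _))// lerD//.
rewrite normrM ger0_norm// ler_wpM2l//.
by rewrite (le_trans (ler_normD _ _))// lerD// mulN1r normrN mul1r.
Qed.

(** On the constant 1, the pieces p and z are bounded by c = (1 - g)^-1, and v and q by C; [gC]
    serves for v and [abC] for q. *)
Lemma shift_inv_majorant_le1 x :
  shift_inv_majorant (cf_cst 1) \at x <= 2 / (a * (1 - g)) + C.
Proof.
have g1' : 0 < 1 - g by rewrite subr_gt0.
have ginv0 : 0 <= g^-1 by rewrite invr_ge0 ltW.
have binv0 : 0 <= b^-1 by rewrite invr_ge0 ltW.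
have C0 : 0 <= C.
  by apply: le_trans gC; rewrite addr_ge0// ?divr_ge0// ?invr_ge0 ltW.
pose c := (1 - g)^-1.
(* This makes the constant c a supersolution for the resolvent of g U. *)
have cE : 1 + g * c = c by rewrite /c; field; rewrite gt_eqF.
have c0 : 0 <= c by rewrite invr_ge0 ltW.
pose u : Y := cf_cst 1.
have u0 y : `|u y| <= 1 by rewrite cfE normr1.
have bnd K1 K2 (S : {linear 'C[R](K1) -> 'C[R](K2)}) (d : R) (f : 'C[R](K1)) :
    nonneg_map S -> (forall y, S (cf_cst 1) \at y <= 1) -> 0 <= d ->
    (forall x, `|f x| <= d) -> forall y, `|S f \at y| <= d.
  move=> S0 S1 d0 fd y.
  apply: le_trans (nonneg_map_dominated S0 (g := cf_cst d) fd y) _.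
  by rewrite cf_cst_scale linearZ cfE ler_piMr//.
have pB k : `|inv_proj NU' u \at k| <= c.
  apply: (resolvent_dominated (@sh_left_ge0 _ _ _ s) (@sh_left_le1 _ _ _ s)
    (l := g) (m := g) (f := sh_left s u) (g := cf_cst 1) (k := cf_cst c)) => //.
  - by rewrite gtr0_norm.
  - by apply: bnd => //; [exact: sh_left_ge0|exact: sh_left_le1].
  - exact: NU'E.
  - move=> y; rewrite !cfE -[leRHS]cE lerD2l (ler_wpM2l (ltW g0))//.
    apply: le_trans (ler_norm _) _; apply: bnd => // [||z].
    + exact: sh_left_ge0.
    + exact: sh_left_le1.
    + by rewrite cfE ger0_norm.
have vB k : `|inv_out 1 NU' u \at k| <= C.
  apply: le_trans gC; rewrite !cfE (le_trans (ler_normD _ _))// lerD ?pB//.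
  rewrite normrM ger0_norm// mulrC ler_wpM2r//.
  rewrite (le_trans (ler_normD _ _))// lerD// ?normr1// mul1r.
  by apply: bnd => //; [exact: sh_proj_ge0|exact: sh_proj_le1].
have zB k : `|inv_mixed 1 NU' u \at k| <= c.
  rewrite !cfE -[leRHS]cE (le_trans (ler_normD _ _))// lerD//.
    by apply: bnd => //; [exact: sh_out_ge0|exact: sh_out_le1].
  rewrite mul1r normrM (gtr0_norm g0) (ler_wpM2l (ltW g0))//.
  exact: (bnd _ _ _ _ _ (@sh_out_ge0 _ _ _ s) (@sh_out_le1 _ _ _ s) c0 pB).
have qB k : `|inv_seq 1 NU' NV' u \at k| <= C.
  apply: (resolvent_dominated (@sh_right_ge0 _ _ _ t) (@sh_right_le1 _ _ _ t)
    (l := a / b) (m := a / b) (f := sh_in t (inv_out 1 NU' u) +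
       b^-1 *: sh_right t (inv_mixed 1 NU' u)) (g := sh_in t (cf_cst C) +
       b^-1 *: sh_right t (cf_cst c)) (k := cf_cst C)) => //.
  - by rewrite gtr0_norm// divr_gt0.
  - by rewrite ltr_pdivrMr// mul1r.
  - move=> y; rewrite !cfE (le_trans (ler_normD _ _))// lerD//.
      exact: (nonneg_map_dominated (@sh_in_ge0 _ _ _ t) (g := cf_cst C) vB).
    rewrite normrM ger0_norm// ler_wpM2l//.
    exact: (nonneg_map_dominated (@sh_right_ge0 _ _ _ t) (g := cf_cst c) zB).
  - exact: NV'E.
  - move=> y; rewrite !(cf_cst_scale _ C) (cf_cst_scale _ c) !linearZ !cfE.
    have V0 : 0 <= sh_right t (cf_cst 1) \at y.
      by apply: sh_right_ge0 => z; rewrite cfE.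
    have := sh_in_right_le1 t y.
    move: V0; set V := sh_right t _ \at y; set I := sh_in t _ \at y => V0 IV.
    (* The constant C is a supersolution for q: [abC] reads c + a C <= b C, which bounds the two
       right-shift terms by C V, and C I + C V <= C. *)
    have : b^-1 * (c * V) + a / b * (C * V) <= C * V.
      rewrite -[leRHS]mul1r -(divff (x := b)) ?gt_eqF//.
      have -> : b^-1 * (c * V) + a / b * (C * V) =
                b^-1 * ((c + a * C) * V) by ring.
      rewrite (mulrC b) -!mulrA ler_wpM2l// mulrA ler_wpM2r//.
      by have := abC; rewrite -/c; lra.
    by rewrite mulr1; have : C * (I + V) <= C * 1 by [exact: ler_wpM2l]; lra.
have -> : 2 / (a * (1 - g)) = a^-1 * (c + c).
  by rewrite /c; field; rewrite !gt_eqF.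
rewrite /shift_inv_majorant inv_formulaE.
have PB := bnd _ _ _ _ _ (@sh_proj_ge0 _ _ _ t) (@sh_proj_le1 _ _ _ t) c0 zB x.
move: (inv_mixed 1 NU' u) (inv_seq 1 NU' NV' u) (zB x) (qB x) PB.
move=> z q zk qk Pk.
rewrite !cfE lerD//; last exact: le_trans (ler_norm _) qk.
rewrite ler_wpM2l ?invr_ge0 ?(ltW a0)// lerD ?mul1r//.
  exact: le_trans (ler_norm _) zk.
exact: le_trans (ler_norm _) Pk.
Qed.

Lemma shift_iso_ge0 : nonneg_map shift_iso.
Proof.
move=> f f0 y; rewrite shift_isoE !cfE.
have v0 x : 0 <= sh_out t f \at x by apply: sh_out_ge0.
rewrite !addr_ge0//.
- by rewrite mulr_ge0// ltW.
- apply: sh_in_ge0 => x; rewrite !cfE addr_ge0// mulr_ge0//; try exact: ltW.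
  exact: sh_left_ge0.
- exact: sh_right_ge0.
Qed.

(** The inserted first term and the right shift together have value at most 1 on constants, and a +
    b = 1; only the summand with g exceeds this. *)
Lemma shift_iso_le1 y : shift_iso (cf_cst 1) \at y <= 1 + g.
Proof.
rewrite shift_isoE !cfE -addrA addrC lerD//; last first.
  by rewrite ler_piMr ?sh_out_le1// ltW.
apply: le_trans (sh_in_right_le1 s y); rewrite lerD//.
  apply: nonneg_map_le; first exact: sh_in_ge0.
  move=> x; rewrite !cfE mulr1 -[leRHS]ab1 lerD2l.
  by rewrite ler_piMr ?sh_left_le1 ?(ltW b0).
apply: nonneg_map_le; first exact: sh_right_ge0.
by move=> x; rewrite cfE sh_out_le1.
Qed.

End shift_isomorphism.

(** * Bounding regular norms by majorants *)

Section regular_norms.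
Variables (R : realType) (K L : compactHausdorffType).
Implicit Types S Q : {linear 'C[R](K) -> 'C[R](L)}.

Lemma positive_operatorP S (M : R) : nonneg_map S ->
  (forall y, S (cf_cst 1) \at y <= M) -> 0 <= M -> positive_operator S.
Proof.
move=> S0 SM M0; split.
  by exists M => f; exact: (dominated_sup_norm (nonneg_map_dominated S0)).
move=> f /cf_leP f0; apply/cf_leP => y; apply: S0 => x.
by have := f0 x; rewrite cfE.
Qed.

Lemma operator_norm_ge0 Q : bounded_operator Q -> 0 <= operator_norm Q.
Proof.
move=> [M QM]; apply: ub_le_sup; last by exists 0 => /=; rewrite ?linear0 normr0.
exists `|M| => _ [f /= f1 <-]; apply: le_trans (QM f) _.
apply: le_trans (ler_norm _) _.
by rewrite normrM normr_id ler_piMr.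
Qed.

Lemma operator_norm_le Q (M : R) : nonneg_map Q ->
  (forall y, Q (cf_cst 1) \at y <= M) -> 0 <= M -> operator_norm Q <= M.
Proof.
move=> Q0 QM M0; apply: ge_sup; first by exists 0, 0; rewrite /= ?linear0 normr0.
move=> _ [f /= f1 <-].
apply: le_trans (dominated_sup_norm (nonneg_map_dominated Q0) QM M0 f) _.
by rewrite ler_piMr.
Qed.

(** Q is one of the operators over which the infimum is taken, its norm is controlled by Q 1, and S
    = (Q + S) - Q. The bound from below serves to multiply two such estimates. *)
Lemma regular_norm_le S Q (M : R) : dominated S Q -> nonneg_map Q ->
  (forall y, Q (cf_cst 1) \at y <= M) -> 0 <= M ->
  regular_operator S /\ 0 <= regular_norm S <= M.
Proof.
move=> SQ Q0 QM M0.
have Sle (f : 'C[R](K)) : (forall x, 0 <= f x) ->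
    forall y, - Q f \at y <= S f \at y <= Q f \at y.
  by move=> f0 y; rewrite -ler_norml; apply: SQ => x; rewrite ger0_norm.
(* Positivity of an operator includes boundedness, which follows here from Z <= 2 Q. *)
have pos (Z : {linear 'C[R](K) -> 'C[R](L)}) :
    (forall f : 'C[R](K), (forall x, 0 <= f x) ->
      forall y, 0 <= Z f \at y <= Q f \at y *+ 2) -> positive_operator Z.
  move=> Z0; apply: (@positive_operatorP _ (M *+ 2)); last by rewrite mulrn_wge0.
    by move=> f f0 y; case/andP: (Z0 f f0 y).
  move=> y; have : 0 <= Z (cf_cst 1) \at y <= Q (cf_cst 1) \at y *+ 2.
    by apply: Z0 => x; rewrite cfE.
  by move=> /andP[_ /le_trans]; apply; rewrite lerMn2r QM orbT.
have pQ : positive_operator Q.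
  apply: pos => f f0 y; have Qf : 0 <= Q f \at y by exact: Q0.
  by rewrite Qf mulr2n lerDl.
have pP : positive_operator (Q \+ S).
  apply: pos => f f0 y; have := Sle f f0 y; rewrite !cfE mulr2n; lra.
have pM : positive_operator (Q \- S).
  apply: pos => f f0 y; have := Sle f f0 y; rewrite !cfE mulr2n; lra.
split.
  exists (Q \+ S), Q; split=> // f /=.
  by rewrite addrAC subrr add0r.
have NS0 : lbound [set operator_norm Z | Z in
    [set Z | [/\ positive_operator Z, operator_le (\- Z) S & operator_le S Z]]] 0.
  by move=> _ [Z [[bZ _] _ _] <-]; exact: operator_norm_ge0.
have NSQ : [set operator_norm Z | Z in
    [set Z | [/\ positive_operator Z, operator_le (\- Z) S & operator_le S Z]]]
    (operator_norm Q).
  exists Q => //; split => //.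
  by apply: pos => f f0 y; have := Sle f f0 y; rewrite !cfE mulr2n; lra.
apply/andP; split; first by apply: lb_le_inf => //; exists (operator_norm Q).
apply: le_trans (operator_norm_le Q0 QM M0).
by apply: ge_inf => //; exists 0.
Qed.

End regular_norms.

Lemma positive_isomorphism_of_shift_systems (R : realType)
    (K L : compactHausdorffType) :
  shift_system R K L -> shift_system R L K ->
  exists (T : {linear 'C[R](K) -> 'C[R](L)})
         (T' : {linear 'C[R](L) -> 'C[R](K)}),
    [/\ positive_isomorphism T T', regular_operator T' &
        regular_norm T * regular_norm T' <= 9 + 6 * Num.sqrt 3].
Proof.
move=> s t.
have [r rE r0] : exists2 r : R, r = Num.sqrt 3 & 0 < r.
  by exists (Num.sqrt 3) => //; rewrite sqrtr_gt0.
have rr : r * r = 3 by rewrite rE -expr2 sqr_sqrtr.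
have r1 : 1 < r by nra.
have r2 : r < 2 by nra.
(* With C = 2/g + (1 - g)^-1 = (9 + 5 r)/2, the constraint [abC] holds with equality for these
   values. *)
pose g := 2 - r; pose b := r / 3; pose a := 1 - b.
have g0 : 0 < g by rewrite /g; lra.
have g1 : g < 1 by rewrite /g; lra.
have a0 : 0 < a by rewrite /a /b; lra.
have ab : a < b by rewrite /a /b; nra.
have ab1 : a + b = 1 by rewrite /a; lra.
have ginv : g^-1 = 2 + r.
  by apply: (mulfI (lt0r_neq0 g0)); rewrite divff ?lt0r_neq0// /g; nra.
have h0 : 0 < 1 - g by lra.
have hinv : (1 - g)^-1 = (r + 1) / 2.
  by apply: (mulfI (lt0r_neq0 h0)); rewrite divff ?lt0r_neq0// /g; nra.
have ainv : a^-1 = (3 + r) / 2.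
  by apply: (mulfI (lt0r_neq0 a0)); rewrite divff ?lt0r_neq0// /a /b; nra.
pose C := 2 / g + (1 - g)^-1.
have abC : (1 - g)^-1 <= (b - a) * C.
  rewrite /C hinv ginv /a /b; nra.
have [NU NUE] : exists N : {linear 'C[R](L) -> 'C[R](L)},
    forall y, N y = y + (- g) *: sh_left s (N y).
  apply: (resolvent_exists (@sh_left_ge0 _ _ _ s) (@sh_left_le1 _ _ _ s)).
  by rewrite normrN gtr0_norm.
have [NU' NU'E] : exists N : {linear 'C[R](L) -> 'C[R](L)},
    forall y, N y = y + g *: sh_left s (N y).
  apply: (resolvent_exists (@sh_left_ge0 _ _ _ s) (@sh_left_le1 _ _ _ s)).
  by rewrite gtr0_norm.
have b0 : 0 < b by exact: lt_trans ab.
have ab0 : 0 < a / b by rewrite divr_gt0.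
have ab_lt1 : a / b < 1 by rewrite ltr_pdivrMr// mul1r.
have [NV NVE] : exists N : {linear 'C[R](K) -> 'C[R](K)},
    forall x, N x = x + (- (a / b)) *: sh_right t (N x).
  apply: (resolvent_exists (@sh_right_ge0 _ _ _ t) (@sh_right_le1 _ _ _ t)).
  by rewrite normrN gtr0_norm.
have [NV' NV'E] : exists N : {linear 'C[R](K) -> 'C[R](K)},
    forall x, N x = x + (a / b) *: sh_right t (N x).
  apply: (resolvent_exists (@sh_right_ge0 _ _ _ t) (@sh_right_le1 _ _ _ t)).
  by rewrite gtr0_norm.
pose T := shift_iso s t g a b.
pose T' := shift_inv s t g a b NU NV.
pose Q := shift_inv_majorant s t g a b NU' NV'.
have M0 : 0 <= 2 / (a * (1 - g)) + C.
  by rewrite /C !addr_ge0// ?divr_ge0 ?invr_ge0// ?mulr_ge0// ltW.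
have g1' : 0 <= 1 + g by rewrite addr_ge0// ltW.
have T0 : nonneg_map T by apply: shift_iso_ge0.
have T1 y : T (cf_cst 1) \at y <= 1 + g by apply: shift_iso_le1.
have T'Q : dominated T' Q by apply: shift_inv_dominated.
have Q0 : nonneg_map Q.
  move=> f f0 x; apply: le_trans (T'Q f f _ x) => // y.
  by rewrite ger0_norm.
have Q1 x : Q (cf_cst 1) \at x <= 2 / (a * (1 - g)) + C.
  by apply: shift_inv_majorant_le1.
exists T, T'; have [rT /andP[nT0 nT]] :=
  regular_norm_le (nonneg_map_dominated T0) T0 T1 g1'.
have [rT' /andP[nT'0 nT']] := regular_norm_le T'Q Q0 Q1 M0.
split=> //.
  split.
  - exact: positive_operatorP T0 T1 g1'.
  - by exists (2 / (a * (1 - g)) + C); exact: dominated_sup_norm T'Q Q1 M0.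
  - by apply: shift_isoK.
  - by apply: shift_invK.
apply: le_trans (ler_pM nT0 nT'0 nT nT') _.
(* The two bounds are 3 - r and (15 + 9 r)/2, whose product is exactly 9 + 6 r. *)
rewrite -rE /C invfM ginv hinv ainv /g; nra.
Qed.

(** * Topology of Cantor cubes *)

Lemma cantor_cube_coord (kappa : Type) (j : kappa) :
  continuous (fun z : cantor_cube kappa => z j).
Proof.
move=> z; have /cvg_sup/(_ j) zj : z --> z by exact: cvg_id.
have := @initial_continuous _ _ (fun z : kappa -> bool => z j) z.
by move=> + U Uz => /(_ U Uz); exact: zj.
Qed.

Lemma cantor_cube_continuous (Z : topologicalType) (kappa : Type)
    (f : Z -> cantor_cube kappa) :
  (forall j, continuous (fun z => f z j)) -> continuous f.
Proof.
move=> fc z; apply/cvg_sup => j.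
have := @continuous_comp_initial _ _ _ (fun z : kappa -> bool => z j) f.
by move=> /(_ (fc j) z).
Qed.

Lemma continuous_bool (Z : topologicalType) (f : Z -> bool) :
  continuous f <-> forall z, \forall y \near z, f y = f z.
Proof.
split=> fc z; first by have := fc z [set f z]; apply.
by move=> U /= /nbhs_singleton Uz; apply: filterS (fc z) => y /= ->.
Qed.

Lemma continuous_indicator (R : realType) (Z : topologicalType) (f : Z -> bool) :
  continuous f -> continuous (fun z => (f z)%:R : R).
Proof.
move=> /continuous_bool fc z; apply: cvg_near_cst.
by apply: filterS (fc z) => y ->.
Qed.

Lemma cantor_cube_zero_dimensional (kappa : Type) :
  zero_dimensional (cantor_cube kappa).
Proof.
move=> x y /eqP xy; have [j xyj] : exists j, x j <> y j.
  by apply/existsNP => H; apply: xy; exact: funext.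
exists ((fun z : cantor_cube kappa => z j) @^-1` [set x j]); split => //.
  apply: preimage_clopen; last exact: cantor_cube_coord.
  by split; [exact: discrete_open|exact: discrete_closed].
by move=> /= /esym.
Qed.

(** Each point of A has a clopen neighbourhood missing B, and by compactness finitely many of them
    cover A. *)
Lemma clopen_separation (kappa : Type) (A B : set (cantor_cube kappa)) :
  closed A -> closed B -> A `&` B = set0 ->
  exists2 U : set (cantor_cube kappa), clopen U & A `<=` U /\ U `&` B = set0.
Proof.
move=> cA cB AB.
(* The finite union is encoded by a filter on clopen sets missing B, that of eventually containing a
   given one; the near-covering form of compactness applies to it. *)
pose F := filter_from
  [set D : set (cantor_cube kappa) | clopen D /\ D `&` B = set0]
  (fun D => [set D' | [/\ D `<=` D', clopen D' & D' `&` B = set0]]).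
have FF : Filter F.
  apply: filter_from_filter.
    by exists set0; split; [exact: clopen0|rewrite set0I].
  move=> D D' [cD DB] [cD' D'B]; exists (D `|` D').
    by split; [exact: clopenU|rewrite setIUl DB D'B setU0].
  move=> V [DV cV VB]; split; split=> // v Dv; apply: DV; [by left|by right].
have : compact A by apply: subclosed_compact cA compactT _.
move=> /compact_near_coveringP/(_ _ F (fun D x => D x) FF)[].
  move=> x Ax; have /= := zero_dimensional_cvg (x := x) hausdorffT
    (@cantor_cube_zero_dimensional kappa) compactT.
  move=> /(_ (~` B))[].
    apply: open_nbhs_nbhs; split; first exact: closed_openC.
    by move=> Bx; have : (A `&` B) x by []; rewrite AB.
  move=> D [Dx cD] DB.
  exists (D, [set D' | [/\ D `<=` D', clopen D' & D' `&` B = set0]]).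
    split=> /=; first by apply: open_nbhs_nbhs; split=> //; case: cD.
    exists D => //; split=> //; by rewrite -subset0 => v [/DB].
  by move=> [v V] /= [Dv [DV _ _]]; exact: DV.
move=> D [cD DB] H; exists D => //; split=> //; apply: H; split=> //.
Qed.

(** * Averaging operators are local on fibres *)

Section averaging.
Variables (R : realType) (Z L : compactHausdorffType).
Variables (q : continuousType Z L) (B : {linear 'C[R](Z) -> 'C[R](L)}).
Hypothesis avg : regular_averaging_operator q B.

Lemma averaging_ge0 : nonneg_map B.
Proof.
move=> f f0 y; have [[_ B0] _] := avg.
have /cf_leP/(_ y) : 0 <= B f by apply: B0; apply/cf_leP => x; rewrite cfE.
by rewrite cfE.
Qed.

Lemma averaging_pullback (f : 'C[R](Z)) (h : 'C[R](L)) :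
  (forall v, f v = h (q v)) -> B f = h.
Proof.
move=> fh; have [_ K] := avg; rewrite -[RHS]K; congr (B _).
exact: cf_ext.
Qed.

Lemma averaging_cst c : B (cf_cst c) = cf_cst c.
Proof. exact: averaging_pullback. Qed.

Lemma averaging_le (f : 'C[R](Z)) (e : R) :
  (forall v, `|f v| <= e) -> forall y, `|B f \at y| <= e.
Proof.
move=> fe y; apply: le_trans (_ : B (cf_cst e) \at y <= e).
  by apply: (nonneg_map_dominated averaging_ge0) => x; rewrite cfE.
by rewrite averaging_cst cfE.
Qed.

(** If f' = f - c vanishes on the fibre of y, the set where |f'| >= e has a closed image missing y.
    A Urysohn function u, 0 at y and 1 on this image, gives |f'| <= e + ||f'|| u(q), and B turns the
    right side into e at y. *)
Lemma averaging_local (f : 'C[R](Z)) (y : L) (c : R) :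
  (forall v, q v = y -> f v = c) -> B f \at y = c.
Proof.
move=> fc; have [f' f'E] : exists f' : 'C[R](Z), f' = f - cf_cst c by eexists.
suff : B f' \at y = 0.
  by rewrite f'E linearB averaging_cst !cfE => /eqP; rewrite subr_eq0 => /eqP.
apply/eqP; rewrite -normr_le0; apply/ler_addgt0Pl => e e0; rewrite addr0.
have nf' : continuous (fun v => `|f' v|).
  by move=> v; apply: cvg_norm; exact: cf_continuous.
pose S := [set v | e <= `|f' v|].
have cS : closed S.
  by apply: (@closed_comp _ _ (fun v => `|f' v|) [set r | e <= r]) => // [v _|].
have cqS : closed (q @` S).
  apply: compact_closed; first exact: hausdorffT.
  apply: continuous_compact; last exact: subclosed_compact cS compactT _.
  by apply: continuous_subspaceT => v; exact: cts_fun.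
have cy : closed [set y].
  by apply: accessible_closed_set1; apply: hausdorff_accessible; exact: hausdorffT.
have yS : [set y] `&` q @` S = set0.
  rewrite -subset0 => _ [-> [v Sv qv]]; move: Sv.
  by rewrite /S /= f'E !cfE fc// subrr normr0 leNgt e0.
have [u [cu uy uS u01]] := @urysohn_ext_itv L R
  (compact_normal hausdorffT compactT) _ _ 0 1 cy cqS yS ltr01.
have u0 v : 0 <= u v by have /= := u01 _ (imageT u v); rewrite in_itv => /andP[].
have fu v : `|f' v| <= (cf_cst e + `|f'| *: pullback q (cf_make cu)) \at v.
  rewrite !cfE; have [ve|ev] := ltP `|f' v| e.
    by rewrite (le_trans (ltW ve))// lerDl mulr_ge0//; exact: u0.
  have -> : pullback q (cf_make cu) v = 1.
    by apply: (uS (u (q v))); exists (q v) => //; exists v.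
  by rewrite mulr1 (le_trans (cf_norm_ge _ _))// lerDr ltW.
apply: le_trans (nonneg_map_dominated averaging_ge0 fu y) _.
rewrite linearD linearZ averaging_cst (averaging_pullback (h := cf_make cu))// !cfE.
have uy0 : u y = 0 by apply: uy; exists y.
by rewrite -[X in _ * X]/(u y) uy0 mulr0 addr0.
Qed.

End averaging.

(** * Extension operators from an embedded cube *)

Lemma pullback_is_linear (R : realType) (Z W : compactHausdorffType)
  (r : continuousType Z W) : linear (@pullback R _ _ r).
Proof. by move=> a f g; apply: cf_ext. Qed.

HB.instance Definition _ (R : realType) (Z W : compactHausdorffType)
  (r : continuousType Z W) := GRing.isLinear.Build R 'C[R](W) 'C[R](Z) _
    (@pullback R _ _ r) (pullback_is_linear r).

Lemma pullbackE (R : realType) (Z W : compactHausdorffType)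
  (r : continuousType Z W) (f : 'C[R](W)) x : pullback r f \at x = f (r x).
Proof. by []. Qed.

(** The map j^-1 q on the preimage of the copy is extended coordinatewise: for each i, the closed
    sets where its i-th bit is 1 and 0 are separated by a clopen set, whose indicator is the new
    bit. *)
Lemma cantor_cube_extension (kappa : Type)
    (L : compactHausdorffType) (q : cantor_cube kappa -> L)
    (j : cantor_cube kappa -> L) :
  continuous q -> continuous j -> injective j ->
  exists2 r : cantor_cube kappa -> cantor_cube kappa,
    continuous r & forall v z, q v = j z -> r v = z.
Proof.
move=> cq cj ij.
pose A b i := [set v | exists2 z : cantor_cube kappa, q v = j z & z i = b].
have cA b i : closed (A b i).
  have -> : A b i = q @^-1` (j @` [set z : cantor_cube kappa | z i = b]).
    apply/seteqP; split=> v /=; first by move=> [z vz zb]; exists z.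
    by move=> [z zb jz]; exists z.
  apply: closed_comp => [v _|]; first exact: cq.
  apply: compact_closed; first exact: hausdorffT.
  apply: continuous_compact; first exact: continuous_subspaceT.
  apply: subclosed_compact compactT _ => //.
  apply: (@closed_comp _ _ (fun z : cantor_cube kappa => z i) [set b]).
    by move=> z _; exact: cantor_cube_coord.
  exact: discrete_closed.
have sep i : {f : cantor_cube kappa -> bool | continuous f &
    forall v z, q v = j z -> f v = z i}.
  apply: cid2; have [|||U [oU cU] [AU UB]] :=
    @clopen_separation kappa (A true i) (A false i).
  - exact: cA.
  - exact: cA.
  - rewrite -subset0 => v [[z vz zi] [z' vz' z'i]]; move: zi.
    by rewrite (ij z z') -?vz// z'i.
  exists (fun v => `[< U v >]).
    apply/continuous_bool => v; have [Uv|nUv] := pselect (U v).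
      apply: filterS (open_nbhs_nbhs (conj oU Uv)) => y Uy.
      by rewrite !asboolT.
    have /open_nbhs_nbhs := conj (closed_openC cU) nUv.
    by apply: filterS => y nUy; rewrite !asboolF.
  move=> v z vz; apply/asboolP; case zi: (z i); first by apply: AU; exists z.
  move=> Uv; have : (U `&` A false i) v by split=> //; exists z.
  by rewrite UB.
exists (fun v i => s2val (sep i) v).
  by apply: cantor_cube_continuous => i; exact: s2valP (sep i).
by move=> v z vz; apply: funext => i; exact: s2valP' (sep i) _ _ vz.
Qed.

(** Take E f = B (f r) with r as above: f r is constantly f z on the fibre of q over j z, so
    [averaging_local] gives E f (j z) = f z. *)
Lemma averaging_extension (R : realType) (kappa : Type)
    (L : compactHausdorffType) (q : continuousType (cantor_cube kappa) L)
    (B : {linear 'C[R](cantor_cube kappa) -> 'C[R](L)})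
    (j : continuousType (cantor_cube kappa) L) :
  regular_averaging_operator q B -> injective j ->
  exists E : {linear 'C[R](cantor_cube kappa) -> 'C[R](L)},
    [/\ nonneg_map E, E (cf_cst 1) = cf_cst 1 & cancel E (pullback j)].
Proof.
move=> avg ij.
have [r cr rE] := cantor_cube_extension (@cts_fun _ _ q) (@cts_fun _ _ j) ij.
pose r' : continuousType (cantor_cube kappa) (cantor_cube kappa) := mkcts cr.
exists (B \o pullback r'); split.
- by move=> f f0 y; apply: (averaging_ge0 avg) => x; rewrite pullbackE.
- by rewrite -[RHS](averaging_cst avg) /=; congr (B _); exact: cf_ext.
- move=> f; apply: cf_ext => z; rewrite pullbackE.
  by apply: (averaging_local avg) => v /rE <-.
Qed.

Lemma closed_copy_embedding (X Y : topologicalType) : contains_closed_copy X Y ->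
  exists2 j : Y -> X, continuous j & injective j.
Proof.
move=> [F _ [f [g [_ cg _ gK]]]]; exists (fun y => \val (g y)).
  move=> y; apply: continuous_comp; first exact: cg.
  exact: initial_continuous.
by move=> y y' /val_inj /(can_inj gK).
Qed.

(** Hilbert's hotel: along an embedded copy e of the naturals, e n moves to e (2n), all other points
    stay, and the added n goes to e (2n + 1). *)
Lemma infinite_sum_injection (kappa : Type) : infinite_set [set: kappa] ->
  exists phi : kappa + nat -> kappa, injective phi.
Proof.
move=> /infiniteP/card_leP[f].
pose e n : kappa := \val (f (to_setT n)).
have ie : injective e.
  move=> m n /val_inj emn.
  have : to_setT m = to_setT n by apply: (@inj _ _ _ f) emn; rewrite inE.
  by move=> /(congr1 val).
pose idx k :=
  if pselect (exists n, e n = k) is left H then Some (projT1 (cid H)) else None.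
have idxE k n : idx k = Some n -> e n = k.
  rewrite /idx; case: pselect => // H [<-]; exact: projT2 (cid H).
have idxN k : idx k = None -> forall n, e n <> k.
  by rewrite /idx; case: pselect => // H _ n en; apply: H; exists n.
pose phi (x : kappa + nat) := match x with
  | inl k => if idx k is Some n then e n.*2 else k
  | inr n => e n.*2.+1 end.
have phil k : (exists n, idx k = Some n /\ phi (inl k) = e n.*2) \/
              (idx k = None /\ phi (inl k) = k).
  by rewrite /phi; case: (idx k) => [n|]; [left; exists n|right].
exists phi => -[k|n] [k'|n'].
- case: (phil k) => [[n [kn ->]]|[kN ->]];
    case: (phil k') => [[n' [kn' ->]]|[kN' ->]].
  + by move=> /ie /double_inj nn'; rewrite -(idxE _ _ kn) -(idxE _ _ kn') nn'.
  + by move=> /idxN-/(_ kN').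
  + by move=> /esym/idxN-/(_ kN).
  + by move=> ->.
- case: (phil k) => [[n [kn ->]]|[kN ->]].
  + by move=> /ie/(congr1 odd); rewrite /= !odd_double.
  + by move=> /esym/idxN-/(_ kN).
- case: (phil k') => [[n' [kn' ->]]|[kN' ->]].
  + by move=> /ie/(congr1 odd); rewrite /= !odd_double.
  + by move=> /idxN-/(_ kN').
- by move=> /ie[/double_inj ->].
Qed.

(** * Coordinates of the cube split into a cube and a bit sequence *)

Section sequence_coordinates.
Variables (kappa : Type) (phi : kappa + nat -> kappa).
Hypothesis phi_inj : injective phi.

Local Notation cube := (cantor_cube kappa).
Local Notation seqs := (cantor_cube nat).

Definition main_part (v : cube) : cube := fun k => v (phi (inl k)).
Definition control_part (v : cube) : seqs := fun n => v (phi (inr n)).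
(** Coordinates outside the range of [phi] are filled with [false]: a section of the pair
    [main_part], [control_part] suffices. *)
Definition combine (z : cube) (w : seqs) : cube := fun k =>
  if pselect (exists x, phi x = k) is left H then
    match projT1 (cid H) with inl i => z i | inr n => w n end
  else false.

Lemma main_part_continuous : continuous main_part.
Proof. by apply: cantor_cube_continuous => k; exact: cantor_cube_coord. Qed.

Lemma control_part_continuous : continuous control_part.
Proof. by apply: cantor_cube_continuous => k; exact: cantor_cube_coord. Qed.

Lemma combine_continuous : continuous (fun zw : cube * seqs => combine zw.1 zw.2).
Proof.
apply: cantor_cube_continuous => k; rewrite /combine.
case: pselect => [H|_]; last by move=> ?; exact: cvg_cst.
case: (projT1 (cid H)) => i zw.
  apply: (continuous_comp (f := fst) (g := fun z : cube => z i)).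
    exact: cvg_fst.
  exact: cantor_cube_coord.
apply: (continuous_comp (f := snd) (g := fun w : seqs => w i)).
  exact: cvg_snd.
exact: cantor_cube_coord.
Qed.

Lemma combineE z w x :
  combine z w (phi x) = match x with inl i => z i | inr n => w n end.
Proof.
rewrite /combine; case: pselect => [H|[]]; last by exists x.
by rewrite (phi_inj (projT2 (cid H))).
Qed.

Lemma main_part_combine z w : main_part (combine z w) = z.
Proof. by apply: funext => k; rewrite /main_part combineE. Qed.

Lemma control_part_combine z w : control_part (combine z w) = w.
Proof. by apply: funext => n; rewrite /control_part combineE. Qed.

End sequence_coordinates.

(* The decreasing sequences of bits, onto which [running_min] projects, form
   the one-point compactification of [nat]. *)
Fixpoint running_min (w : cantor_cube nat) (n : nat) : bool :=
  if n is m.+1 then running_min w m && w n else w 0%N.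

Section running_min.
Local Notation seqs := (cantor_cube nat).
Implicit Types w : seqs.

(** With n encoded as n ones followed by zeros, [prepend_true] is the successor, [seq_tail] the
    predecessor (fixing 0) and [zero_seq] the index of the first term; the constant sequence of ones
    is infinity. *)
Definition prepend_true w : seqs := fun n => if n is m.+1 then w m else true.
Definition seq_tail w : seqs := fun n => w n.+1.
Definition zero_seq : seqs := fun _ => false.

Lemma running_min_continuous : continuous (running_min : seqs -> seqs).
Proof.
apply: cantor_cube_continuous; elim=> [|n IH] /=; first exact: cantor_cube_coord.
apply/continuous_bool => w.
near=> w'; congr (_ && _); near: w'.
  by move/continuous_bool: IH; exact.
by have /continuous_bool := @cantor_cube_coord nat n.+1; exact.
Unshelve. all: by end_near. Qed.

Lemma prepend_true_continuous : continuous prepend_true.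
Proof.
apply: cantor_cube_continuous => -[|n] /=; last exact: cantor_cube_coord.
by move=> ?; exact: cvg_cst.
Qed.

Lemma seq_tail_continuous : continuous seq_tail.
Proof. by apply: cantor_cube_continuous => n; exact: cantor_cube_coord. Qed.

Lemma running_minK w : running_min (running_min w) = running_min w.
Proof.
apply: funext; elim=> [//|n IH] /=; rewrite IH.
by case: (running_min w n).
Qed.

Lemma running_min_prepend w :
  running_min (prepend_true w) = prepend_true (running_min w).
Proof. by apply: funext => -[//|]; elim=> [//|n /= ->]. Qed.

Lemma running_min_tail w :
  running_min (seq_tail (running_min w)) = seq_tail (running_min w).
Proof.
apply: funext; elim=> [//|n IH]; rewrite /= IH /seq_tail /=.
by case: (running_min w n); case: (w n.+1).
Qed.

Lemma running_min_true w : w 0%N ->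
  prepend_true (seq_tail (running_min w)) = running_min w.
Proof. by move=> w0; apply: funext => -[|n] //=; rewrite w0. Qed.

Lemma running_min_false w : w 0%N = false -> running_min w = zero_seq.
Proof. by move=> w0; apply: funext; elim=> [//|n /= ->]. Qed.

Lemma seq_tail_prepend w : seq_tail (prepend_true w) = w.
Proof. by []. Qed.

End running_min.

(** * Functions on the cube as continuous families in C(K) *)

Section sliced_operators.
Variables (R : realType) (kappa : Type) (K : compactHausdorffType).
Variables (phi : kappa + nat -> kappa).
Hypothesis phi_inj : injective phi.
Variables (p : continuousType (cantor_cube kappa) K)
  (A : {linear 'C[R](cantor_cube kappa) -> 'C[R](K)}).
Hypothesis avg : regular_averaging_operator p A.

Local Notation cube := (cantor_cube kappa).
Local Notation seqs := (cantor_cube nat).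

(** Joint continuity in w and x, phrased by test maps so that it applies directly to [control_part]
    and [p \o main_part]. *)
Definition jointly_continuous (h : seqs -> 'C[R](K)) :=
  forall (Z : topologicalType) (m : Z -> seqs) (k : Z -> K),
    continuous m -> continuous k -> continuous (fun z => h (m z) (k z)).

Lemma slice_continuous (f : 'C[R](cube)) (w : seqs) :
  continuous (fun z => f (combine phi z w)).
Proof.
move=> z; apply: (continuous_comp (f := fun z => combine phi z w) (g := f)).
  apply: (continuous_comp (f := fun z : cube => (z, w))
    (g := fun zw : cube * seqs => combine phi zw.1 zw.2)).
    move=> U [[U1 U2] /= [U1z U2w] UU]; apply: filterS U1z => z' U1z'.
    by apply: UU; split=> //=; exact: nbhs_singleton.
  exact: combine_continuous.
exact: cf_continuous.
Qed.

Definition slice (w : seqs) (f : 'C[R](cube)) : 'C[R](cube) :=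
  cf_make (@slice_continuous f w).

Lemma slice_is_linear w : linear (slice w).
Proof. by move=> a f g; exact: cf_ext. Qed.

HB.instance Definition _ w := GRing.isLinear.Build R 'C[R](cube) 'C[R](cube) _
  (slice w) (slice_is_linear w).

(** Compactness of the cube makes the slices of f vary continuously in the supremum norm. *)
Lemma slice_near (f : 'C[R](cube)) (w : seqs) (e : R) : 0 < e ->
  \forall w' \near w, forall z, `|slice w' f z - slice w f z| <= e.
Proof.
move=> e0; have /compact_near_coveringP := @compactT cube.
move=> /(_ _ (nbhs w) (fun w' z => `|slice w' f z - slice w f z| <= e) _).
move=> H; apply: filterS (H _) => [w' + z|z _]; first exact.
have e2 : 0 < e / 2 by rewrite divr_gt0.
have c1 : \forall z' \near z & w' \near w,
    `|f (combine phi z w) - f (combine phi z' w')| < e / 2.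
  have cf : continuous (fun zw : cube * seqs => f (combine phi zw.1 zw.2)).
    move=> zw; apply: (continuous_comp
      (f := fun zw : cube * seqs => combine phi zw.1 zw.2) (g := f)).
      exact: combine_continuous.
    exact: cf_continuous.
  by have /cvgrPdist_lt/(_ _ e2) := cf (z, w).
have c2 : \forall z' \near z & w' \near w,
    `|f (combine phi z w) - f (combine phi z' w)| < e / 2.
  have /cvgrPdist_lt/(_ _ e2) H2 := @slice_continuous f w z.
  exists ([set z' | `|f (combine phi z w) - f (combine phi z' w)| < e / 2], setT).
    by split; [exact: H2|exact: filterT].
  by move=> [z' w'] [].
apply: filter_app c1; apply: filterS c2 => -[z' w'] /= h2 h1.
rewrite !cfE; move: h1 h2; rewrite !ltr_norml ler_norml.
by move=> /andP[? ?] /andP[? ?]; apply/andP; split; lra.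
Qed.

(** A family in C(K) indexed by bit sequences; over the decreasing ones it is a convergent sequence
    in C(K). *)
Definition hat (f : 'C[R](cube)) (w : seqs) : 'C[R](K) := A (slice w f).

Lemma hat_jointly_continuous f : jointly_continuous (hat f).
Proof.
move=> Z m k cm ck z0; apply/cvgrPdist_le => e e0.
have e2 : 0 < e / 2 by rewrite divr_gt0.
have c1 : \forall z \near z0, forall y,
    `|hat f (m z) y - hat f (m z0) y| <= e / 2.
  have : \forall z \near z0,
      forall v, `|slice (m z) f v - slice (m z0) f v| <= e / 2.
    exact: cm z0 _ (slice_near f (m z0) e2).
  apply: filterS => z mz y.
  have -> : hat f (m z) y - hat f (m z0) y =
            A (slice (m z) f - slice (m z0) f) \at y by rewrite linearB cfE.
  by apply: (averaging_le avg) => v; rewrite !cfE; exact: mz.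
have c2 : \forall z \near z0,
    `|hat f (m z0) (k z0) - hat f (m z0) (k z)| <= e / 2.
  have ch : continuous (fun z => hat f (m z0) (k z)).
    move=> z; apply: (continuous_comp (f := k) (g := hat f (m z0))).
      exact: ck.
    exact: cf_continuous.
  by have /cvgrPdist_le/(_ _ e2) := ch z0.
apply: filter_app c1; apply: filterS c2 => z h2 /(_ (k z)) h1.
move: h1 h2; rewrite !ler_norml.
by move=> /andP[? ?] /andP[? ?]; apply/andP; split; lra.
Qed.

Section glue.
Variables (chi : seqs -> bool) (h : seqs -> 'C[R](K)).
Hypotheses (cchi : continuous chi) (ch : jointly_continuous h).

Lemma glue_slices_continuous : continuous (fun v : cube =>
  (chi (control_part phi v))%:R * h (control_part phi v) (p (main_part phi v))).
Proof.
move=> v; apply: cvgM.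
  apply: (continuous_comp (f := control_part phi) 
    (g := fun w => (chi w)%:R : R)).
    exact: control_part_continuous.
  exact: continuous_indicator.
apply: ch; first exact: control_part_continuous.
move=> u; apply: (continuous_comp (f := main_part phi) (g := p)).
  exact: main_part_continuous.
exact: cts_fun.
Qed.

Definition glue_slices : 'C[R](cube) := cf_make (@glue_slices_continuous).

(** The slice at w of the glued function is the pullback along p of [(chi w)%:R *: h w], which A
    undoes. The cutoff [chi] allows 0 to be inserted at some indices. *)
Lemma hat_glue_slices w : hat glue_slices w = (chi w)%:R *: h w.
Proof.
apply: (averaging_pullback avg) => z.
rewrite cfE -[LHS]/((chi (control_part phi (combine phi z w)))%:R *
  h (control_part phi (combine phi z w)) (p (main_part phi (combine phi z w)))).
by rewrite control_part_combine// main_part_combine.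
Qed.

End glue.

Lemma cst_jointly_continuous (x : 'C[R](K)) : jointly_continuous (fun=> x).
Proof.
move=> Z m k cm ck z; apply: (continuous_comp (f := k) (g := x)).
  exact: ck.
exact: cf_continuous.
Qed.

End sliced_operators.

(** * Shifts on the cube and their transport to C(L) *)

Section shift_system_construction.
Variables (R : realType) (kappa : Type) (K L : compactHausdorffType).
Variables (phi : kappa + nat -> kappa).
Hypothesis phi_inj : injective phi.
Variables (p : continuousType (cantor_cube kappa) K)
  (A : {linear 'C[R](cantor_cube kappa) -> 'C[R](K)}).
Hypothesis avg : regular_averaging_operator p A.

Local Notation cube := (cantor_cube kappa).
Local Notation seqs := (cantor_cube nat).
Local Notation hat := (hat phi A).

Lemma hat_is_linear w : linear (hat^~ w).
Proof. exact: (linearP (A \o slice phi w)). Qed.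

Lemma hat_cst c w : hat (cf_cst c) w = cf_cst c.
Proof. exact: (averaging_pullback avg). Qed.

Lemma hat_ge0 (f : 'C[R](cube)) w :
  (forall v, 0 <= f v) -> forall x, 0 <= hat f w x.
Proof. by move=> f0; apply: (averaging_ge0 avg) => z; exact: f0. Qed.

Section hat_op.
Variables (chi : seqs -> bool) (m : seqs -> seqs).
Hypotheses (cchi : continuous chi) (cm : continuous m).

Lemma hat_comp_jointly_continuous f : jointly_continuous (fun w => hat f (m w)).
Proof.
move=> Z k l ck cl; apply: (hat_jointly_continuous avg) => //.
by move=> z; apply: (continuous_comp (f := k) (g := m)); [exact: ck|exact: cm].
Qed.

(** Reindexes the family of f by m and cuts it off by [chi]. The projection and both shifts have
    this form, so by [hat_hat_op] their relations reduce to identities between maps of bit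
    sequences. *)
Definition hat_op_fun (f : 'C[R](cube)) : 'C[R](cube) :=
  glue_slices phi p cchi (@hat_comp_jointly_continuous f).

Lemma hat_op_funE f v : hat_op_fun f v =
  (chi (control_part phi v))%:R *
  hat f (m (control_part phi v)) (p (main_part phi v)).
Proof. by []. Qed.

Lemma hat_op_is_linear : linear hat_op_fun.
Proof.
move=> a f g; apply: cf_ext => v.
by rewrite !cfE !hat_op_funE hat_is_linear !cfE; ring.
Qed.

HB.instance Definition _ := GRing.isLinear.Build R 'C[R](cube) 'C[R](cube) _
  hat_op_fun hat_op_is_linear.

Definition hat_op : {linear 'C[R](cube) -> 'C[R](cube)} := hat_op_fun.

Lemma hat_opE f v : hat_op f \at v =
  (chi (control_part phi v))%:R *
  hat f (m (control_part phi v)) (p (main_part phi v)).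
Proof. by []. Qed.

Lemma hat_hat_op f w : hat (hat_op f) w = (chi w)%:R *: hat f (m w).
Proof. exact: (hat_glue_slices phi_inj avg). Qed.

Lemma hat_op_ge0 : nonneg_map hat_op.
Proof.
move=> f f0 v; rewrite hat_opE mulr_ge0//; exact: hat_ge0.
Qed.

Lemma hat_op_cst v : hat_op (cf_cst 1) \at v = (chi (control_part phi v))%:R.
Proof. by rewrite hat_opE hat_cst cfE mulr1. Qed.

End hat_op.

Section insert_op.
Variables (chi : seqs -> bool) (cchi : continuous chi).

Definition insert_op_fun (x : 'C[R](K)) : 'C[R](cube) :=
  glue_slices phi p cchi (@cst_jointly_continuous R K x).

Lemma insert_op_funE (x : 'C[R](K)) v : insert_op_fun x v =
  (chi (control_part phi v))%:R * x (p (main_part phi v)).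
Proof. by []. Qed.

Lemma insert_op_is_linear : linear insert_op_fun.
Proof.
move=> a f g; apply: cf_ext => v.
by rewrite !cfE !insert_op_funE !cfE; ring.
Qed.

HB.instance Definition _ := GRing.isLinear.Build R 'C[R](K) 'C[R](cube) _
  insert_op_fun insert_op_is_linear.

Definition insert_op : {linear 'C[R](K) -> 'C[R](cube)} := insert_op_fun.

Lemma insert_opE (x : 'C[R](K)) v : insert_op x \at v =
  (chi (control_part phi v))%:R * x (p (main_part phi v)).
Proof. by []. Qed.

Lemma hat_insert_op x w : hat (insert_op x) w = (chi w)%:R *: x.
Proof. exact: (hat_glue_slices phi_inj avg). Qed.

End insert_op.

Let continuous_true : continuous (fun _ : seqs => true).
Proof. by move=> w; exact: cvg_cst. Qed.

Let continuous_head : continuous (fun w : seqs => w 0%N).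
Proof. exact: cantor_cube_coord. Qed.

Let continuous_not_head : continuous (fun w : seqs => ~~ w 0%N).
Proof.
apply/continuous_bool => w.
by have /continuous_bool/(_ w) := continuous_head; apply: filterS => y ->.
Qed.

Let continuous_prepend : continuous (fun w => prepend_true (running_min w)).
Proof.
move=> w; apply: (continuous_comp (f := running_min : seqs -> seqs) 
  (g := prepend_true)).
  exact: running_min_continuous.
exact: prepend_true_continuous.
Qed.

Let continuous_tail : continuous (fun w => seq_tail (running_min w)).
Proof.
move=> w; apply: (continuous_comp (f := running_min : seqs -> seqs) 
  (g := seq_tail)).
  exact: running_min_continuous.
exact: seq_tail_continuous.
Qed.

(** The left shift reads the term at the successor, the right shift the one at the predecessor. The
    head bit is [false] exactly at index 0, where [right] vanishes and [first] is supported. *)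
Let proj := hat_op continuous_true running_min_continuous.
Let left := hat_op continuous_true continuous_prepend.
Let right := hat_op continuous_head continuous_tail.
Let first := insert_op continuous_not_head.
Let out : {linear 'C[R](cube) -> 'C[R](K)} := A \o slice phi zero_seq.

Let out_hat f : out f = hat f zero_seq. Proof. by []. Qed.

Let running_min_zero : running_min zero_seq = zero_seq.
Proof. exact: running_min_false. Qed.

Let proj_proj f : proj (proj f) = proj f.
Proof.
by apply: cf_ext => v; rewrite !hat_opE hat_hat_op running_minK !cfE !mul1r.
Qed.

Let left_proj f : left (proj f) = left f.
Proof.
apply: cf_ext => v; rewrite !hat_opE hat_hat_op running_min_prepend.
by rewrite running_minK !cfE !mul1r.
Qed.

Let proj_left f : proj (left f) = left f.
Proof.
by apply: cf_ext => v; rewrite !hat_opE hat_hat_op running_minK !cfE !mul1r.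
Qed.

Let right_proj f : right (proj f) = right f.
Proof.
apply: cf_ext => v; rewrite !hat_opE hat_hat_op running_min_tail.
by rewrite !cfE !mul1r.
Qed.

Let proj_right f : proj (right f) = right f.
Proof.
by apply: cf_ext => v; rewrite !hat_opE hat_hat_op running_minK !cfE !mul1r.
Qed.

Let proj_first x : proj (first x) = first x.
Proof.
by apply: cf_ext => v; rewrite hat_opE insert_opE hat_insert_op !cfE !mul1r.
Qed.

Let out_proj f : out (proj f) = out f.
Proof. by rewrite !out_hat hat_hat_op running_min_zero scale1r. Qed.

Let left_right f : left (right f) = proj f.
Proof.
apply: cf_ext => v; rewrite !hat_opE hat_hat_op running_min_prepend running_minK.
by rewrite seq_tail_prepend !cfE !mul1r.
Qed.

Let left_first x : left (first x) = 0.
Proof.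
by apply: cf_ext => v; rewrite hat_opE hat_insert_op !cfE mul0r mulr0.
Qed.

Let out_first x : out (first x) = x.
Proof. by rewrite out_hat hat_insert_op scale1r. Qed.

Let out_right f : out (right f) = 0.
Proof. by rewrite out_hat hat_hat_op scale0r. Qed.

Let first_out f : first (out f) + right (left f) = proj f.
Proof.
apply: cf_ext => v; rewrite cfE insert_opE !hat_opE hat_hat_op.
rewrite running_min_tail out_hat !cfE !mul1r.
(* At a positive index, predecessor and successor cancel and only the shifts contribute; at index 0
   only the first term does. *)
case: (boolP (control_part phi v 0%N)) => [w0|/negbTE w0].
  by rewrite running_min_true// mul0r add0r mul1r.
by rewrite running_min_false// mul1r mul0r addr0.
Qed.

Variables (j : continuousType cube L) (E : {linear 'C[R](cube) -> 'C[R](L)}).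
Hypotheses (E0 : nonneg_map E) (E1 : E (cf_cst 1) = cf_cst 1).
Hypothesis (EK : cancel E (pullback j)).

Let J : {linear 'C[R](L) -> 'C[R](cube)} := pullback j.

Let E_le1 (f : 'C[R](cube)) : (forall v, f v <= 1) -> forall y, E f \at y <= 1.
Proof.
move=> f1 y; have <- : E (cf_cst 1) \at y = 1 by rewrite E1 cfE.
by apply: nonneg_map_le => // v; rewrite cfE.
Qed.

Let J1 : J (cf_cst 1) = cf_cst 1. Proof. exact: cf_ext. Qed.

Let JE f : J (E f) = f. Proof. exact: EK. Qed.

Let J_ge0 (f : 'C[R](L)) : (forall y, 0 <= f y) -> forall v, 0 <= J f \at v.
Proof. by move=> f0 v; exact: f0. Qed.

(** All maps are conjugated by the extension E and the restriction J; as J E is the identity, the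
    relations on the cube carry over. *)
Definition shift_system_of_extension : shift_system R K L.
Proof.
apply: (@ShiftSystem R K L (E \o (proj \o J)) (E \o (left \o J))
  (E \o (right \o J)) (E \o first) (out \o J)).
- by move=> f f0; apply/E0/hat_op_ge0/J_ge0.
- by move=> f f0; apply/E0/hat_op_ge0/J_ge0.
- by move=> f f0; apply/E0/hat_op_ge0/J_ge0.
- move=> f f0; apply: E0 => v; rewrite insert_opE mulr_ge0//; exact: f0.
- by move=> f f0; apply/hat_ge0/J_ge0.
- by apply: E_le1 => v; rewrite /= J1 hat_op_cst lern1 leq_b1.
- by apply: E_le1 => v; rewrite /= J1 hat_op_cst lern1 leq_b1.
- by move=> x; rewrite -[leLHS]/(hat (J (cf_cst 1)) zero_seq x) J1 hat_cst cfE.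
- move=> y.
  have -> : (E \o first) (cf_cst 1) \at y +
      (E \o (right \o J)) (cf_cst 1) \at y =
      E (first (cf_cst 1) + right (J (cf_cst 1))) \at y.
    by rewrite [in RHS]linearD.
  (* [first] and [right] live on the complementary sets where the head bit is 0 and 1. *)
  apply: E_le1 => v; rewrite cfE J1 hat_op_cst insert_opE !cfE mulr1 -natrD lern1.
  by case: (control_part _ _ _).
- by move=> f; rewrite /= JE proj_proj.
- by move=> f; rewrite /= JE left_proj.
- by move=> f; rewrite /= JE proj_left.
- by move=> f; rewrite /= JE right_proj.
- by move=> f; rewrite /= JE proj_right.
- by move=> f; rewrite /= JE proj_first.
- by move=> f; rewrite -[LHS]/(out (J (E (proj (J f))))) JE out_proj.
- by move=> f; rewrite /= JE left_right.
- by move=> f; rewrite /= JE left_first linear0.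
- by move=> f; rewrite -[LHS]/(out (J (E (first f)))) JE out_first.
- by move=> f; rewrite -[LHS]/(out (J (E (right (J f))))) JE out_right.
- by move=> f; rewrite -[RHS]/(E (proj (J f))) -first_out linearD /= JE.
Qed.

End shift_system_construction.

Theorem theorem4p1 (R : realType) (kappa : Type)
    (K L : compactHausdorffType) :
  infinite_set [set: kappa] ->
  Miljutin_compactum R kappa K ->
  Miljutin_compactum R kappa L ->
  contains_closed_copy K (cantor_cube kappa) ->
  contains_closed_copy L (cantor_cube kappa) ->
  exists (T : {linear 'C[R](K) -> 'C[R](L)})
         (T' : {linear 'C[R](L) -> 'C[R](K)}),
    [/\ positive_isomorphism T T', regular_operator T' &
        regular_norm T * regular_norm T' <= 9 + 6 * Num.sqrt 3].
Proof.
move=> /infinite_sum_injection[phi phi_inj].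
move=> [_ [p [_ [A avgA]]]] [_ [q [_ [B avgB]]]].
move=> /closed_copy_embedding[i ci ii] /closed_copy_embedding[j cj ij].
have [E [E0 E1 EK]] := averaging_extension (j := mkcts ci) avgA ii.
have [F [F0 F1 FK]] := averaging_extension (j := mkcts cj) avgB ij.
apply: positive_isomorphism_of_shift_systems.
(* Averaging onto K by A encodes sequences in C(K) on the cube, and F, from the copy in L, carries
   them to C(L); the second system exchanges the roles. *)
- exact: (shift_system_of_extension (j := mkcts cj) phi_inj avgA F0 F1 FK).
- exact: (shift_system_of_extension (j := mkcts ci) phi_inj avgB E0 E1 EK).
Qed.
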